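(* There exist absolute constants $\alpha, \beta > 0$ such that for every constant $c > 0$ there are constants $C_1, C_2 > 0$ (depending only on $c$) with the following property. Let $n \ge 1$, $p \ge 1$, and let $\varepsilon, \delta$ satisfy $p^{-1/3} \le \varepsilon \le 1/2$, $\delta \ge p^{-c}$, $\delta \ge \alpha e^{-\beta\varepsilon^2 p}$, $\delta < 1$, and $1/\delta \in \mathbb{N}$. Consider the multi-processor smoothed greedy algorithm on $n$ cups for the renormalized multi-processor cup game with parameters $p,\varepsilon,\delta$. Then for every oblivious filler, every step $i$, and every real $k \ge \log p$, the backlog after step $i$ is at most $C_1 k/\varepsilon$ with probability at least $1 - C_2 e^{-e^{k}}$.
   Context: Renormalized multi-processor cup game with parameters $p,\varepsilon,\delta$: $n$ cups, initially empty; in each step the filler pours nonnegative amounts $c_j(i) \le 1$ into the cups with $\sum_j c_j(i) \le (1-\varepsilon)p$, then the emptier selects up to $p+1$ distinct cups and removes up to $1+2\delta$ units from each. The filler is oblivious (all amounts fixed in advance, independent of the emptier's randomness). The backlog after a step is the maximum fill of any cup. Thresholds (defined for $1/\delta = D \in \mathbb{N}$): for each cup $j$ and each integer $i \ge 1$ with $i \equiv 1 \pmod{D+1}$, draw an independent uniform $s_j(i) \in (0,1]$; the thresholds of cup $j$ are all numbers $(i+t) + s_j(i)$ for $t = 1,\dots,D$ and such $i$ (there are no other thresholds). Let $a_j(i)$ be the total water poured by the filler into cup $j$ during the first $i$ steps ($a_j(0)=0$). Cup $j$ crosses a threshold $x$ in step $i$ if $a_j(i-1) < x \le a_j(i)$.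 Multi-processor smoothed greedy algorithm: each cup $j$ has a counter $w_j$, initially $0$. In each step, after the filler pours, $w_j$ is increased by $1+\delta$ for each threshold of cup $j$ crossed in that step. The emptier then selects up to $p+1$ distinct cups, giving priority to cups with $w_j \ge 1+\delta$ over all other cups, and to cups with $w_j \ne 0$ over cups with $w_j = 0$; within each priority level it selects the fullest cups. From each selected cup $j$ it removes $t_j = \min(1+2\delta, w_j)$ units of water and sets $w_j \leftarrow w_j - t_j$. *)

(* Defs.v *)
From HB Require Import structures.
From mathcomp Require Export all_boot all_order all_algebra.
From mathcomp Require Export all_classical all_reals all_analysis.

Set Implicit Arguments.
Unset Strict Implicit.
Unset Printing Implicit Defensive.

Import Order.TTheory GRing.Theory Num.Theory.

Local Open Scope classical_set_scope.
Local Open Scope ring_scope.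

Section Independence.
Context {d : measure_display} {T : measurableType d} {R : realType}.

Definition mutually_independent (P : probability T R) (I : eqType)
    (X : I -> {RV P >-> R}) : Prop :=
  forall (r : seq I) (B : I -> set R), uniq r ->
    (forall i, i \in r -> measurable (B i)) ->
    P (\big[setI/setT]_(i <- r) (X i @^-1` B i))
      = (\prod_(i <- r) P (X i @^-1` B i))%E.

(* The law [uniform_prob] on [0, 1] is also the uniform law on ]0, 1]. *)
Definition uniform_on_unit (P : probability T R) (X : {RV P >-> R}) : Prop :=
  (forall w, 0 < X w <= 1) /\
  (forall B : set R, measurable B ->
     distribution P X B = uniform_prob (@ltr01 R) B).

End Independence.

Section CupGame.
Context {R : realType} {n : nat}.

(* Steps are numbered from 1: [c i j] is the amount poured into cup [j] in
   step [i], and the values [c 0 j] are never used. *)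
Definition filler := nat -> 'I_n -> R.

Definition filler_ok (p : nat) (eps : R) (c : filler) : Prop :=
  forall i, (1 <= i)%N ->
    (forall j, 0 <= c i j <= 1) /\ \sum_(j < n) c i j <= (1 - eps) * p%:R.

Definition poured (c : filler) (i : nat) (j : 'I_n) : R :=
  \sum_(1 <= h < i.+1) c h j.

(* The integers i >= 1 with i = 1 %[mod D.+1] are the m * D.+1 + 1 for m : nat;
   [s m] is the uniform draw attached to i = m * D.+1 + 1. *)
Definition thresholds (D : nat) (s : nat -> R) : set R :=
  [set x | exists m t : nat,
     (1 <= t <= D)%N /\ x = (m * D.+1 + 1 + t)%:R + s m].

Definition crossed (D : nat) (s : 'I_n -> nat -> R) (c : filler)
    (i : nat) (j : 'I_n) : set R :=
  thresholds D (s j) `&` [set x | poured c i.-1 j < x <= poured c i j].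

Record state := State { fill : 'I_n -> R; counter : 'I_n -> R }.

Definition empty_state : state := State (fun=> 0) (fun=> 0).

(* At most finitely many thresholds lie in a bounded interval, so the finitely
   supported sum [\sum_(x \in _) _] has its intended value here. *)
Definition pour (D : nat) (delta : R) (s : 'I_n -> nat -> R) (c : filler)
    (i : nat) (st : state) : state :=
  State (fun j => fill st j + c i j)
        (fun j => counter st j + \sum_(x \in crossed D s c i j) (1 + delta)).

Definition priority (delta : R) (st : state) (j : 'I_n) : nat :=
  if 1 + delta <= counter st j then 2%N
  else if counter st j != 0 then 1%N else 0%N.

Definition may_precede (delta : R) (st : state) (j l : 'I_n) : bool :=
  (priority delta st l < priority delta st j)%N ||
  ((priority delta st l == priority delta st j) && (fill st l <= fill st j)).

(* Ties may be broken in any way, and selecting fewer than p + 1 cups is only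
   allowed when every unselected cup has counter 0 (nothing would be removed
   from such a cup). *)
Definition greedy_selection (p : nat) (delta : R) (st : state)
    (S : {set 'I_n}) : Prop :=
  [/\ (#|S| <= p.+1)%N,
      forall j, j \notin S -> counter st j != 0 -> #|S| = p.+1
    & forall j l, j \in S -> l \notin S -> may_precede delta st j l].

(* Selected set as a function of the step and of the state the emptier sees
   after the filler's pour; its only freedom is in breaking ties. *)
Definition selection_rule := nat -> state -> {set 'I_n}.

Definition smoothed_greedy_rule (p : nat) (delta : R)
    (rule : selection_rule) : Prop :=
  forall i st, greedy_selection p delta st (rule i st).

Definition remove (delta : R) (S : {set 'I_n}) (st : state) : state :=
  let t j := if j \in S then Num.min (1 + 2 * delta) (counter st j) else 0 in
  State (fun j => fill st j - t j) (fun j => counter st j - t j).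

Fixpoint run (D : nat) (delta : R) (rule : selection_rule)
    (s : 'I_n -> nat -> R) (c : filler) (i : nat) : state :=
  if i is i'.+1 then
    let st := pour D delta s c i (run D delta rule s c i') in
    remove delta (rule i st) st
  else empty_state.

(* Fills are nonnegative along a run: by the time the counter of a cup has
   received (1 + delta) * q in total, at least that much water was poured. *)
Definition backlog (st : state) : R := \big[Num.max/0]_(j < n) fill st j.

End CupGame.

Arguments filler R n : clear implicits.
Arguments state R n : clear implicits.
Arguments selection_rule R n : clear implicits.

(* Main.v *)
Require Import Defs.
From mathcomp Require Import ring lra zify.

Set Implicit Arguments.
Unset Strict Implicit.
Unset Printing Implicit Defensive.

Import Order.TTheory GRing.Theory Num.Theory.

Local Open Scope classical_set_scope.
Local Open Scope ring_scope.

(* Write W for the sum of the counters and Y for the number of cups crossing a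
   threshold in a step (each cup crosses at most one). Counters are multiples of
   delta, and serving the top priority level first makes W drop by at least
   delta whenever Y <= p; in general W' <= max 0 (W - delta + 3 (Y - p)^+). As Y
   has mean at most (1 - eps) p, the excess (Y - p)^+ has mean
   exp(- Omega(eps^2 p)), which the lower bound on delta makes at most delta / 12.
   Its sums over windows of steps are Lipschitz functions of the independent
   draws, hence concentrate, and W t exceeds y with probability
   exp(- y / poly(p, 1 / delta)).

   The number of unselected cups of fill at least 8 is at most W, because the fill
   exceeds the counter by at most 3. A greedy step therefore contracts
   Phi = \sum_j (exp(eps / 16 * (fill j - 8)^+) - 1) by a factor
   1 + Omega(eps delta) / max 1 W, up to an additive 2 W. The tail of W makes all
   W u with u <= t at most sqrt (x^2 + t - u) outside an event of probability
   exp(- exp k), for some x polynomial in exp k, and unrolling the recursion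
   bounds Phi t by a polynomial in exp k. Taking logarithms bounds the fills by
   O(k / eps). Nothing here depends on the number of cups. *)

Section Clamp.
Context {R : realType}.
Implicit Types A B x y z : R.

Definition clamp A z := Num.max 0 (Num.min A z).

Lemma clamp_ge0 A z : 0 <= clamp A z.
Proof. by rewrite /clamp le_max lexx. Qed.

Lemma clamp_le A z : 0 <= A -> clamp A z <= A.
Proof. by move=> A0; rewrite /clamp ge_max A0 ge_min lexx. Qed.

Lemma clampD A B z : 0 <= A -> 0 <= B ->
  clamp A z + clamp B (z - A) = clamp (A + B) z.
Proof.
move=> A0 B0; rewrite /clamp /Order.max /Order.min.
by repeat case: ifPn => //; rewrite -?leNgt => *; lra.
Qed.

Lemma clamp_homo A x y : x <= y -> clamp A x <= clamp A y.
Proof.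
move=> xy; rewrite /clamp /Order.max /Order.min.
by repeat case: ifPn => //; rewrite -?leNgt => *; lra.
Qed.

Lemma clamp_lipschitz A x y : x <= y -> clamp A y - clamp A x <= y - x.
Proof.
move=> xy; rewrite /clamp /Order.max /Order.min.
by repeat case: ifPn => //; rewrite -?leNgt => *; lra.
Qed.

Lemma clamp_id A z : 0 <= z <= A -> clamp A z = z.
Proof.
move=> /andP[z0 zA]; rewrite /clamp /Order.max /Order.min.
by repeat case: ifPn => //; rewrite -?leNgt => *; lra.
Qed.

Lemma sum_clamp A z L : 0 <= A ->
  \sum_(0 <= m < L) clamp A (z - m%:R * A) = clamp (L%:R * A) z.
Proof.
move=> A0; elim: L => [|L IH].
  by rewrite big_nil mul0r /clamp /Order.max /Order.min; repeat case: ifPn => //;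
    rewrite -?leNgt => *; lra.
rewrite big_nat_recr //= IH clampD ?mulr_ge0 //.
by rewrite -natr1 mulrDl mul1r.
Qed.

Lemma clamp_scale (D : nat) z : (0 < D)%N ->
  clamp D.+1%:R z <= (1 + D%:R^-1) * clamp D%:R z.
Proof.
move=> D0; have D0' : 0 < D%:R :> R by rewrite ltr0n.
have E : (1 + D%:R^-1) * D%:R = D.+1%:R :> R.
  by rewrite mulrDl mul1r mulVf ?gt_eqF // -natr1.
have I0 : 0 < D%:R^-1 :> R by rewrite invr_gt0.
have [zD|Dz] := leP z D%:R; last first.
  have -> : clamp D%:R z = D%:R.
    by rewrite /clamp (min_l (ltW Dz)) max_r.
  by rewrite E clamp_le.
have [z0|z0] := leP z 0.
  have -> : clamp D.+1%:R z = 0.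
    rewrite /clamp; apply/max_l; rewrite ge_min z0 orbT //.
  by rewrite mulr_ge0 ?clamp_ge0 // addr_ge0 // ltW.
rewrite !clamp_id ?(ltW z0) //=; last by rewrite (le_trans zD) // ler_nat.
by rewrite ler_peMl ?(ltW z0) // lerDl ltW.
Qed.

End Clamp.

(** * Expectation over independent finite coordinates *)

Lemma expR_quadratic (R : realType) (z : R) :
  z <= 4^-1 -> expR z <= 1 + z + z ^+ 2.
Proof.
move=> z4; have z1 : 0 < 1 - z / 2 by lra.
have := expR_ge1Dx (- (z / 2)); rewrite expRN => h.
have h2 : expR (z / 2) <= (1 - z / 2)^-1.
  by rewrite -[leLHS]invrK lef_pV2 // posrE invr_gt0 expR_gt0.
have -> : expR z = expR (z / 2) ^+ 2 by rewrite -expRM_natl; congr expR; lra.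
apply: (@le_trans _ _ ((1 - z / 2)^-1 ^+ 2)).
  by rewrite lerXn2r ?nnegrE ?expR_ge0 // invr_ge0 ltW.
rewrite exprVn -[leLHS]mul1r ler_pdivrMr ?exprn_gt0 //.
rewrite -subr_ge0.
have -> : (1 + z + z ^+ 2) * (1 - z / 2) ^+ 2 - 1 =
   (z / 2) ^+ 2 * ((1 - 3 * z) + z ^+ 2) by field.
by rewrite mulr_ge0 ?sqr_ge0 // addr_ge0 ?sqr_ge0 //; lra.
Qed.

Section ProductExpectation.
Context {R : realType} {I : eqType} {A : finType} (q : I -> A -> R).
Hypothesis q_ge0 : forall k a, 0 <= q k a.
Hypothesis q_sum1 : forall k, \sum_a q k a = 1.
Implicit Types (r : seq I) (F G : (I -> A) -> R) (om : I -> A) (k : I).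

Definition upd om k a : I -> A := fun l => if l == k then a else om l.

Fixpoint Ex r F om : R :=
  if r is k :: r' then \sum_a q k a * Ex r' F (upd om k a) else F om.

Lemma eq_Ex r F G om : F =1 G -> Ex r F om = Ex r G om.
Proof. by move=> FG; elim: r om => //= k r IH om; apply: eq_bigr => a _; rewrite IH. Qed.

Lemma Ex_le r F G om : (forall om', F om' <= G om') -> Ex r F om <= Ex r G om.
Proof.
move=> FG; elim: r om => //= k r IH om.
by apply: ler_sum => a _; rewrite ler_wpM2l.
Qed.

Lemma Ex_cst r c om : Ex r (fun=> c) om = c.
Proof.
elim: r om => //= k r IH om.
by under eq_bigr do rewrite IH; rewrite -mulr_suml q_sum1 mul1r.
Qed.

Lemma ExD r F G om : Ex r (fun x => F x + G x) om = Ex r F om + Ex r G om.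
Proof.
elim: r om => //= k r IH om.
by rewrite -big_split; apply: eq_bigr => a _; rewrite IH mulrDr.
Qed.

Lemma ExZ r c F om : Ex r (fun x => c * F x) om = c * Ex r F om.
Proof.
elim: r om => //= k r IH om.
by rewrite mulr_sumr; apply: eq_bigr => a _; rewrite IH mulrCA.
Qed.

Lemma Ex_sum (J : Type) (s : seq J) r (F : J -> (I -> A) -> R) om :
  Ex r (fun x => \sum_(j <- s) F j x) om = \sum_(j <- s) Ex r (F j) om.
Proof.
elim: s => [|j s IH].
  rewrite big_nil -[RHS](Ex_cst r 0 om).
  by apply: eq_Ex => x; rewrite big_nil.
rewrite big_cons -IH -ExD; apply: eq_Ex => x; by rewrite big_cons.
Qed.

Lemma Ex_coord_notin r k (g : A -> R) om : k \notin r ->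
  Ex r (fun x => g (x k)) om = g (om k).
Proof.
elim: r om => //= l r IH om; rewrite inE negb_or => /andP[kl kr].
under eq_bigr do rewrite IH // /upd (negbTE kl).
by rewrite -mulr_suml q_sum1 mul1r.
Qed.

Lemma Ex_coord r k (g : A -> R) om : k \in r -> uniq r ->
  Ex r (fun x => g (x k)) om = \sum_a q k a * g a.
Proof.
elim: r om => //= l r IH om; rewrite inE => /predU1P[<-{l}|kr] /andP[lr ur].
  by apply: eq_bigr => a _; rewrite Ex_coord_notin // /upd eqxx.
by under eq_bigr do rewrite IH //; rewrite -mulr_suml q_sum1 mul1r.
Qed.

Lemma Ex_lipschitz r F k b om om' :
  (forall x y, (forall l, l != k -> x l = y l) -> x k = om k -> y k = om' k ->
     F x <= F y + b) ->
  k \notin r -> (forall l, l != k -> om l = om' l) ->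
  Ex r F om <= Ex r F om' + b.
Proof.
move=> HF; elim: r om om' HF => [|l r IH] om om' HF /=.
  by move=> _ E; apply: HF.
rewrite inE negb_or => /andP[kl kr] E.
rewrite -[b]mul1r -(q_sum1 l) mulr_suml -big_split /=.
apply: ler_sum => a _; rewrite -mulrDr ler_wpM2l //; apply: IH => //.
  by rewrite /upd (negbTE kl).
by move=> m mk; rewrite /upd; case: ifP => // _; apply: E.
Qed.

Variables (a0 : A) (N : I -> A -> R) (eta : R).
Hypothesis eta_ge0 : 0 <= eta.
Hypothesis N_small : forall k a, q k a != 0 -> eta * N k a <= 4^-1.

(* Conditioning on the coordinates one at a time: conditionally on the others,
   the centred exponent is at most [eta * N], and [expR z <= 1 + z + z ^+ 2]
   turns this into a second moment bound. *)
Lemma Ex_expR_le r F om : uniq r ->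
  (forall k x y, (forall l, l != k -> x l = y l) -> y k = a0 ->
     `|F x - F y| <= N k (x k)) ->
  Ex r (fun x => expR (eta * F x)) om <=
    expR (eta * Ex r F om + eta ^+ 2 * \sum_(k <- r) \sum_a q k a * N k a ^+ 2).
Proof.
move=> ur HF; elim: r ur om => [|k r IH] /=.
  by move=> _ om; rewrite big_nil mulr0 addr0.
move=> /andP[kr ur] om; rewrite big_cons.
set V := \sum_(_ <- r) _; set v := \sum_a q k a * N k a ^+ 2.
pose X a := Ex r F (upd om k a).
have HX a : `|X a - X a0| <= N k a.
  rewrite ler_distlC; apply/andP; split.
  - rewrite lerBlDr; apply: (@Ex_lipschitz _ _ k) => //.
      rewrite /upd eqxx => x y xy xk yk; rewrite -lerBlDl.
      by rewrite -xk (le_trans (ler_norm _)) // HF.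
    by move=> l lk; rewrite /upd (negbTE lk).
  - apply: (@Ex_lipschitz _ _ k) => //.
      rewrite /upd eqxx => x y xy xk yk; rewrite -lerBlDl.
      rewrite -yk (le_trans (ler_norm _)) // distrC HF //.
      by move=> l lk; rewrite xy.
    by move=> l lk; rewrite /upd (negbTE lk).
apply: (@le_trans _ _ (\sum_a q k a * expR (eta * X a + eta ^+ 2 * V))).
  by apply: ler_sum => a _; rewrite ler_wpM2l // IH.
have -> : \sum_a q k a * expR (eta * X a + eta ^+ 2 * V) =
    expR (eta * X a0 + eta ^+ 2 * V) *
      \sum_a q k a * expR (eta * (X a - X a0)).
  rewrite mulr_sumr; apply: eq_bigr => a _; rewrite mulrCA -expRD.
  by congr (_ * expR _); ring.
apply: (@le_trans _ _ (expR (eta * X a0 + eta ^+ 2 * V) *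
   (1 + (\sum_a q k a * (eta * (X a - X a0)) + eta ^+ 2 * v)))).
  rewrite ler_pM2l ?expR_gt0 // -(q_sum1 k) mulr_sumr -!big_split /=.
  apply: ler_sum => a _.
  have [->|qa] := eqVneq (q k a) 0; first by rewrite !mul0r mulr0 !addr0.
  have Na : eta * (X a - X a0) <= eta * N k a.
    by rewrite ler_wpM2l // (le_trans (ler_norm _)).
  suff le : expR (eta * (X a - X a0)) <=
      1 + (eta * (X a - X a0) + eta ^+ 2 * N k a ^+ 2).
    apply: le_trans (ler_wpM2l (q_ge0 k a) le) _.
    by rewrite le_eqVlt; apply/orP; left; apply/eqP; ring.
  apply: le_trans (expR_quadratic (le_trans Na (N_small qa))) _.
  rewrite -addrA !lerD2l exprMn ler_wpM2l ?sqr_ge0 //.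
  rewrite -real_normK ?num_real // lerXn2r ?nnegrE ?normr_ge0 //.
  by rewrite (le_trans (normr_ge0 _) (HX a)).
apply: le_trans (ler_wpM2l (expR_ge0 _) (expR_ge1Dx _)) _.
rewrite -expRD ler_expR.
have -> : \sum_a q k a * (eta * (X a - X a0)) =
   eta * \sum_a q k a * X a - eta * X a0.
  rewrite -[X in _ - X]mul1r -(q_sum1 k) mulr_suml mulr_sumr -sumrB.
  by apply: eq_bigr => a _; ring.
by rewrite le_eqVlt; apply/orP; left; apply/eqP; rewrite /X; ring.
Qed.

End ProductExpectation.

Section IndependentCoordinates.
Context {d : measure_display} {T : measurableType d} {R : realType}.
Context (P : probability T R) {I : eqType} {A : finType} (X : T -> I -> A).
Hypothesis measurable_coord : forall k a, measurable [set w | X w k = a].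
Hypothesis indep_coord : forall (r : seq I) (om : I -> A), uniq r ->
  P (\big[setI/setT]_(k <- r) [set w | X w k = om k]) =
  (\prod_(k <- r) P [set w | X w k = om k])%E.

Definition law k a : R := fine (P [set w | X w k = a]).

Lemma lawE k a : (law k a)%:E = P [set w | X w k = a].
Proof. by rewrite fineK // fin_num_measure. Qed.

Lemma law_ge0 k a : 0 <= law k a.
Proof. exact: fine_ge0. Qed.

Lemma prob_split k (S : set T) : measurable S ->
  P S = (\sum_a P (S `&` [set w | X w k = a]))%E.
Proof.
move=> mS; transitivity (\sum_(a \in [set: A]) P (S `&` [set w | X w k = a]))%E.
  rewrite -measure_fin_bigcup //; first last.
  - by move=> a _; apply: measurableI.
  - by move=> a b _ _ [w [[_ /= <-] [_ <-]]].
  - exact: finite_finset.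
  - congr (P _); apply/seteqP; split=> [w Sw|w [a _ []] //].
    by exists (X w k).
rewrite (fsbigE (index_enum A)) ?index_enum_uniq //; last first.
  by move=> a _; rewrite mem_index_enum.
by apply: eq_bigl => a; rewrite in_setT.
Qed.

Lemma law_sum1 k : \sum_a law k a = 1.
Proof.
apply: EFin_inj; rewrite -(@probability_setT _ _ _ P) (prob_split k) //.
by rewrite -sumEFin; apply: eq_bigr => a _; rewrite setTI lawE.
Qed.

Let box (r : seq I) (om : I -> A) :=
  \big[setI/setT]_(k <- r) [set w | X w k = om k].

Let mbox r om : measurable (box r om).
Proof. by apply: bigsetI_measurable. Qed.

Lemma boxP r om w : box r om w <-> {in r, forall k, X w k = om k}.
Proof.
rewrite /box; elim: r => [|k r IH]; first by rewrite big_nil.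
rewrite big_cons; split.
  by move=> [/= Hk /IH Hr] l; rewrite inE => /predU1P[->//|/Hr].
move=> H; split=> /=; first by apply: H; rewrite inE eqxx.
by apply/IH => l lr; apply: H; rewrite inE lr orbT.
Qed.

Lemma prob_box_Ex r0 r om (S : (I -> A) -> bool) : uniq (r0 ++ r) ->
  (forall om1 om2, {in r0 ++ r, om1 =1 om2} -> S om1 = S om2) ->
  measurable ([set w | S (X w)] `&` box r0 om) /\
  P ([set w | S (X w)] `&` box r0 om) =
    (\prod_(k <- r0) law k (om k) * Ex law r (fun x => (S x)%:R) om)%:E.
Proof.
elim: r r0 om => [|k r IH] r0 om.
  rewrite cats0 => ur SE /=.
  have -> : [set w | S (X w)] `&` box r0 om = if S om then box r0 om else set0.
    apply/seteqP; split => w /=.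
      by move=> [Sw /boxP bw]; rewrite -(SE (X w)) // Sw; apply/boxP.
    case: ifP => // So bw; split=> //.
    by rewrite (SE _ om) //; apply/boxP.
  case: ifP => _; last by rewrite measure0 mulr0; split.
  split; first exact: mbox.
  rewrite mulr1 /box indep_coord // -prodEFin; apply: eq_bigr => k _.
  by rewrite lawE.
move=> ur SE /=.
have pe : perm_eq ((k :: r0) ++ r) (r0 ++ k :: r).
  by rewrite cat_cons perm_sym perm_catC /= perm_cons perm_catC.
have kr0 : k \notin r0.
  by move: ur; rewrite -(perm_uniq pe) /= mem_cat negb_or => /andP[/andP[]].
have boxE a : box (k :: r0) (upd om k a) = box r0 om `&` [set w | X w k = a].
  rewrite /box big_cons setIC; congr (_ `&` _); last first.
    by apply/seteqP; split => w /=; rewrite /upd eqxx.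
  rewrite !big_seq; apply: eq_bigr => l lr; apply/seteqP; split => w /=;
    by rewrite /upd; case: eqP => // lk; rewrite -lk lr in kr0.
have {}IH a : measurable ([set w | S (X w)] `&` box r0 om `&` [set w | X w k = a]) /\
   P ([set w | S (X w)] `&` box r0 om `&` [set w | X w k = a]) =
   (\prod_(k <- r0) law k (om k) *
     (law k a * Ex law r (fun x => (S x)%:R) (upd om k a)))%:E.
  rewrite -setIA -boxE.
  have [||m e] := IH (k :: r0) (upd om k a).
  - by rewrite (perm_uniq pe).
  - by move=> o1 o2 E; apply: SE => l; rewrite -(perm_mem pe); exact: E.
  split=> //; rewrite e big_cons mulrA [_ * law k a]mulrC; congr (_ * _ * _)%:E.
    by rewrite /upd eqxx.
  rewrite !big_seq; apply: eq_bigr => l lr.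
  by rewrite /upd; case: eqP => // lk; rewrite -lk lr in kr0.
have mS : measurable ([set w | S (X w)] `&` box r0 om).
  have -> : [set w | S (X w)] `&` box r0 om = \big[setU/set0]_(a : A)
      ([set w | S (X w)] `&` box r0 om `&` [set w | X w k = a]).
    rewrite -big_distrr /= -[LHS]setIT; congr (_ `&` _).
    apply/seteqP; split=> // w _; rewrite -bigcup_seq.
    by exists (X w k) => //=; rewrite mem_index_enum.
  by apply: bigsetU_measurable => a _; have [] := IH a.
split=> //; rewrite (prob_split k) //.
rewrite mulr_sumr -sumEFin; apply: eq_bigr => a _; exact: (IH a).2.
Qed.

Lemma prob_Ex r om (S : (I -> A) -> bool) : uniq r ->
  (forall om1 om2, {in r, om1 =1 om2} -> S om1 = S om2) ->
  measurable [set w | S (X w)] /\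
  P [set w | S (X w)] = (Ex law r (fun x => (S x)%:R) om)%:E.
Proof.
move=> ur SE; have := @prob_box_Ex [::] r om S ur SE.
by rewrite /box !big_nil mul1r setIT.
Qed.

End IndependentCoordinates.

(** * One step of the algorithm *)

Section Step.
Context {R : realType} {n p : nat} {delta : R}.
Hypotheses (delta_gt0 : 0 < delta) (delta_lt1 : delta < 1).
Variables (st : state R n) (S : {set 'I_n}).
Hypothesis sel : greedy_selection p delta st S.

Let st' := remove delta S st.

Lemma counter_removed j :
  counter st' j = if j \in S then Num.max 0 (counter st j - (1 + 2 * delta))
                  else counter st j.
Proof.
rewrite /st' /remove /=; case: ifP => _; last by rewrite subr0.
rewrite /Order.max /Order.min.
by repeat case: ifPn => //; rewrite -?leNgt => *; lra.
Qed.

Lemma fill_removed j :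
  fill st' j = if j \in S then fill st j - Num.min (1 + 2 * delta) (counter st j)
               else fill st j.
Proof. by rewrite /st' /remove /=; case: ifP => _ //; rewrite subr0. Qed.

Lemma priority2 j : (priority delta st j == 2)%N = (1 + delta <= counter st j).
Proof. by rewrite /priority; case: ifP => // _; case: ifP. Qed.

Lemma priority_le2 j : (priority delta st j <= 2)%N.
Proof. by rewrite /priority; case: ifP => // _; case: ifP. Qed.

Lemma selected_above j l : l \notin S -> 1 + delta <= counter st l ->
  j \in S -> 1 + delta <= counter st j /\ fill st l <= fill st j.
Proof.
case: sel => _ _ prec lS wl jS; have := prec _ _ jS lS.
have := wl; rewrite -priority2 => /eqP pl.
have := priority_le2 j; rewrite -priority2 /may_precede pl => pj.
case/orP => [h|/andP[/eqP <- ->]//].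
by have := leq_trans h pj.
Qed.

Lemma selected_full l : l \notin S -> counter st l != 0 -> #|S| = p.+1.
Proof. by case: sel => _ full _; apply: full. Qed.

Variables (w : 'I_n -> R) (x : 'I_n -> bool).
Hypothesis counterE : forall j, counter st j = w j + (1 + delta) * (x j)%:R.
Hypothesis w_discrete : forall j, w j = 0 \/ delta <= w j.

Let W := \sum_j w j.
Let Y : R := \sum_j (x j)%:R.

Let w_ge0 j : 0 <= w j.
Proof. by case: (w_discrete j) => [->//|]; apply: le_trans; apply: ltW. Qed.

Let YE : Y = (\sum_j x j)%:R.
Proof. by rewrite natr_sum. Qed.

Lemma total_counter_step :
  \sum_j counter st' j <= Num.max 0 (W - delta + 3 * Num.max 0 (Y - p%:R)).
Proof.
have d0 := delta_gt0; have d1 := delta_lt1.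
set Z := Num.max 0 (Y - p%:R).
have Z0 : 0 <= Z by rewrite le_max lexx.
have YZ : Y <= p%:R + Z by rewrite -lerBlDl le_max lexx orbT.
have Ysplit : (Y <= p%:R) || (p%:R + 1 <= Y).
  by rewrite YE natr1 !ler_nat leqNgt orNb.
have Zcase : (Y <= p%:R) || (1 <= Z).
  by case/orP: Ysplit => [->//|h]; apply/orP; right; rewrite le_max; apply/orP; right; lra.
have [l /andP[lS wl]|nobig] := pickP (fun l => (l \notin S) && (1 + delta <= counter st l)).
  have Scard : #|S| = p.+1.
    by apply: (selected_full lS); rewrite gt_eqF // (lt_le_trans _ wl) // addr_gt0.
  have le j : counter st' j <= w j + (1 + delta) * ((x j)%:R - (j \in S)%:R).
    rewrite counter_removed; case: ifP => jS /=; last by rewrite counterE subr0.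
    have [+ _] := selected_above lS wl jS; rewrite counterE => h.
    rewrite mulrBr mulr1 ge_max; move: h; set y := _ * (x j)%:R => h.
    by apply/andP; split; lra.
  have : \sum_j counter st' j <= W + (1 + delta) * (Y - p.+1%:R).
    apply: (le_trans (ler_sum _ (fun j _ => le j))).
    rewrite big_split /= lerD2l -mulr_sumr sumrB ler_wpM2l //; first by lra.
    by rewrite lerD2l -Scard lerN2 -natr_sum -sum1_card big_mkcond.
  move=> h; apply: (le_trans h); rewrite le_max; apply/orP; right.
  rewrite -natr1.
  case/orP: Zcase => [h1|h1].
    have : 0 <= (1 + delta) * (p%:R - Y) by rewrite mulr_ge0 //; lra.
    lra.
  have h2 : 0 <= (1 - delta) * (Z - 1) by rewrite mulr_ge0 //; lra.
  have h3 : 0 <= (1 + delta) * (p%:R + Z - Y) by rewrite mulr_ge0 //; lra.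
  lra.
have xS j : j \notin S -> x j = false.
  move=> jS; apply/negbTE/negP => xj; have := nobig j.
  by rewrite jS counterE xj /= => /negP; apply; rewrite mulr1 lerDr.
have le j : counter st' j <= w j.
  rewrite counter_removed counterE; case: ifPn => jS; last by rewrite (xS j jS) mulr0 addr0.
  by rewrite ge_max w_ge0 /=; case: (x j) => /=; lra.
case/orP: Zcase => [Yp|Z1]; last first.
  rewrite le_max; apply/orP; right.
  by apply: (le_trans (ler_sum _ (fun j _ => le j))); rewrite -/W; lra.
have [j /andP[jS wj]|noold] := pickP (fun j => (j \in S) && (w j != 0)).
  have {}wj : delta <= w j by case: (w_discrete j) => // w0; rewrite w0 eqxx in wj.
  rewrite le_max; apply/orP; right.
  have -> : W = w j + \sum_(i | i != j) w i by rewrite /W (bigD1 j).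
  rewrite (bigD1 j) //.
  have : counter st' j <= w j - delta.
    rewrite counter_removed jS counterE ge_max; apply/andP; split; first lra.
    by case: (x j) => /=; lra.
  move=> h; apply: (le_trans (lerD h (ler_sum _ (fun i _ => le i)))).
  by lra.
rewrite big1 ?le_max ?lexx // => l _.
have w0 j : j \in S -> w j = 0.
  by move=> jS; have := noold j; rewrite jS /= => /negbFE/eqP.
rewrite counter_removed; case: ifPn => lS.
  apply/max_l; rewrite counterE w0 //; case: (x l) => /=; lra.
have [//|wl] := eqVneq (counter st l) 0.
have Scard := selected_full lS wl.
have xS1 j : j \in S -> x j.
  move=> jS; case: sel => _ _ /(_ _ _ jS lS).
  rewrite /may_precede /priority (counterE j) w0 //.
  case: (x j) => //=; rewrite mulr0 addr0 eqxx /=.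
  have -> : (1 + delta <= 0) = false by apply/negbTE; rewrite -ltNge; lra.
  have -> : (1 + delta <= counter st l) = false by have := nobig l; rewrite lS.
  by rewrite wl.
suff : p.+1%:R <= Y by rewrite -natr1; lra.
rewrite YE ler_nat -Scard -sum1_card [leqLHS]big_mkcond /=.
by apply: leq_sum => j _; case: ifP => // /xS1 ->.
Qed.

End Step.

Section Potential.
Context {R : realType} (lam : R).

Definition psi (z : R) : R := expR (lam * Num.max 0 (z - 8)) - 1.

Hypothesis lam_ge0 : 0 <= lam.

Lemma psi_ge0 z : 0 <= psi z.
Proof. by rewrite subr_ge0 -expR0 ler_expR mulr_ge0 // le_max lexx. Qed.

Lemma psi_eq0 z : z <= 8 -> psi z = 0.
Proof. by move=> z8; rewrite /psi max_l ?mulr0 ?expR0 ?subrr // subr_le0. Qed.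

Lemma psiE z : 8 <= z -> psi z = expR (lam * (z - 8)) - 1.
Proof. by move=> z8; rewrite /psi max_r // subr_ge0. Qed.

Lemma psi_geE z : expR (lam * (z - 8)) - 1 <= psi z.
Proof. by rewrite /psi lerD2r ler_expR ler_wpM2l // le_max lexx orbT. Qed.

Lemma psi_homo y z : y <= z -> psi y <= psi z.
Proof.
move=> yz; rewrite /psi lerD2r ler_expR ler_wpM2l //.
by rewrite ge_max !le_max lexx /= lerB // orbT.
Qed.

Lemma psi_drop (delta c f th : R) : lam <= 32^-1 -> 0 <= delta <= 1 ->
  0 <= c <= 1 -> 12 <= th -> th <= f + c ->
  psi (f + c - (1 + 2 * delta)) + lam * delta * expR (lam * (f - 8))
    + lam * expR (lam * (th - 8)) * (1 - 4 * lam) * (1 - c) <= psi f.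
Proof.
have l0 := lam_ge0; move=> l1 /andP[d0 d1] /andP[c0 c1] th12 thf.
rewrite !psiE; [|by lra|by lra].
set Th := expR (lam * (th - 8)); have Th0 : 0 <= Th := expR_ge0 _.
set E := expR (lam * (f - 8)); have E0 : 0 <= E := expR_ge0 _.
have u0 : 0 <= lam * (1 - c) by rewrite mulr_ge0 // subr_ge0.
have u1 : 0 <= lam * c by rewrite mulr_ge0.
have ld0 : 0 <= lam * delta by rewrite mulr_ge0.
have ld1 : 0 <= lam * (1 - delta) by rewrite mulr_ge0 // subr_ge0.
set z := lam * (1 - c) + 2 * lam * delta.
have -> : lam * (f + c - (1 + 2 * delta) - 8) = lam * (f - 8) + - z.
  by rewrite /z; ring.
rewrite expRD -/E.
have z0 : 0 <= z by rewrite /z; lra.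
have z3 : z <= 3 * lam by rewrite /z; lra.
have ez : expR (- z) <= 1 + - z + (- z) ^+ 2 by apply: expR_quadratic; lra.
have zz : z ^+ 2 <= 3 * lam * z by rewrite expr2 ler_wpM2r.
have ez' : E * expR (- z) <= E * (1 - (1 - 3 * lam) * z).
  by rewrite ler_wpM2l //; move: ez; rewrite sqrrN; lra.
have ETh : (1 - lam) * Th <= E.
  have : Th * expR (- lam) <= E.
    have : 0 <= lam * (f - th + 1) by rewrite mulr_ge0 //; lra.
    by rewrite -expRD ler_expR; lra.
  have : Th * (1 + - lam) <= Th * expR (- lam) by rewrite ler_wpM2l ?expR_ge1Dx.
  lra.
have q1 : (1 - 4 * lam) * Th <= (1 - 3 * lam) * E.
  have : (1 - 3 * lam) * ((1 - lam) * Th) <= (1 - 3 * lam) * E.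
    by rewrite ler_wpM2l //; lra.
  have : 0 <= lam ^+ 2 * Th by rewrite mulr_ge0 ?sqr_ge0.
  lra.
have q2 := ler_wpM2l u0 q1.
have l6 : 0 <= 1 - 6 * lam by lra.
have q3 := mulr_ge0 (mulr_ge0 ld0 E0) l6.
by move: ez' q2 q3; rewrite /z; lra.
Qed.

Lemma psi_rise (c f th : R) : 0 <= c -> f + c <= th ->
  psi (f + c) - lam * expR (lam * (th - 8)) * c <= psi f.
Proof.
have l0 := lam_ge0; move=> c0 fth.
have lc0 : 0 <= lam * c by rewrite mulr_ge0.
have [f8|f8] := leP (f + c) 8.
  rewrite psi_eq0 // sub0r (le_trans _ (psi_ge0 _)) // oppr_le0.
  by rewrite !mulr_ge0 ?expR_ge0.
apply: le_trans (psi_geE _); rewrite psiE ?(ltW f8) //.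
have -> : lam * (f - 8) = lam * (f + c - 8) + - (lam * c) by ring.
rewrite expRD; set Q := expR (lam * _); set Th := expR _.
have Q0 : 0 <= Q := expR_ge0 _.
have QTh : Q <= Th by rewrite ler_expR ler_wpM2l // lerD2r.
have : Q * (1 + - (lam * c)) <= Q * expR (- (lam * c)).
  by rewrite ler_wpM2l // expR_ge1Dx.
have : (lam * c) * Q <= (lam * c) * Th by rewrite ler_wpM2l.
lra.
Qed.

End Potential.

Section PotentialStep.
Context {R : realType} {n p : nat} {eps delta : R}.
Hypotheses (eps_gt0 : 0 < eps) (eps_le : eps <= 2^-1) (epsp : 1 <= eps * p%:R).
Hypotheses (delta_gt0 : 0 < delta) (delta_lt1 : delta < 1).
Variables (st : state R n) (S : {set 'I_n}).
Hypothesis sel : greedy_selection p delta st S.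
Let st' := remove delta S st.
Variables (f c : 'I_n -> R).
Hypothesis fillE : forall j, fill st j = f j + c j.
Hypothesis c01 : forall j, 0 <= c j <= 1.
Hypothesis sum_c : \sum_j c j <= (1 - eps) * p%:R.
Hypothesis counter_ge0 : forall j, 0 <= counter st j.
Hypothesis fill_le : forall j, fill st j <= counter st j + 3.

Let lam := eps / 16.
Let kap := eps * delta / 32.
Let W := \sum_j counter st' j.

Let lam_ge0 : 0 <= lam. Proof. by rewrite /lam; have := eps_gt0; lra. Qed.
Let lam_le : lam <= 32^-1. Proof. by rewrite /lam; have := eps_le; lra. Qed.
Let kapE : kap = lam * delta / 2. Proof. by rewrite /kap /lam; field. Qed.
Let kap_ge0 : 0 <= kap.
Proof. by rewrite kapE divr_ge0 // mulr_ge0 // ltW. Qed.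

Let sum_split_sel (g : 'I_n -> R) :
  \sum_j g j = \sum_(j in S) g j + \sum_(j | j \notin S) g j.
Proof. by rewrite (bigID (mem S)). Qed.

Let counter'_ge0 j : 0 <= counter st' j.
Proof. by rewrite counter_removed; case: ifP => // _; rewrite le_max lexx. Qed.

Let W_ge0 : 0 <= W. Proof. exact: sumr_ge0. Qed.

Let counter_big j z : z + 3 <= fill st j -> z <= counter st j.
Proof. by have := fill_le j; lra. Qed.

Let fill_sel j : j \in S -> 6 <= fill st j ->
  fill st' j = f j + c j - (1 + 2 * delta).
Proof.
move=> jS f6; rewrite fill_removed jS -fillE min_l //.
by apply: counter_big; have := delta_lt1; lra.
Qed.

Lemma psi_selected j : j \in S -> (1 + kap) * psi lam (fill st' j) <= psi lam (f j).
Proof.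
move=> jS; have d0 := delta_gt0; have /andP[_ c1] := c01 j.
have [f6|f6] := leP 6 (fill st j); last first.
  rewrite [X in _ * X]psi_eq0 ?mulr0 ?psi_ge0 //.
  rewrite fill_removed jS.
  have : 0 <= Num.min (1 + 2 * delta) (counter st j).
    by rewrite le_min counter_ge0 andbT; lra.
  lra.
have [f8|f8] := leP (fill st' j) 8; first by rewrite psi_eq0 ?mulr0 ?psi_ge0.
apply: le_trans (psi_geE lam_ge0 _).
rewrite psiE ?(ltW f8) //.
have : lam * (fill st' j - 8) <= lam * (f j - 8) - 2 * lam * delta.
  have : 0 <= lam * (1 - c j) by rewrite mulr_ge0 //; lra.
  by rewrite (fill_sel jS f6); lra.
rewrite -ler_expR expRD => h.
have k1 : (1 + kap) * expR (- (2 * lam * delta)) <= 1.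
  rewrite expRN ler_pdivrMr ?expR_gt0 // mul1r.
  apply: le_trans (expR_ge1Dx _) _; rewrite ler_expR kapE.
  have : 0 <= lam * delta by rewrite mulr_ge0 // ltW.
  lra.
have k0 := kap_ge0.
have := ler_wpM2l (expR_ge0 (lam * (f j - 8))) k1.
have : (1 + kap) * expR (lam * (fill st' j - 8)) <=
   (1 + kap) * (expR (lam * (f j - 8)) * expR (- (2 * lam * delta))).
  by rewrite ler_wpM2l //; lra.
lra.
Qed.

Lemma psi_unselected_le (th : R) : 8 <= th ->
  (forall j, j \notin S -> fill st j <= th) ->
  \sum_(j | j \notin S) psi lam (fill st' j) <= (expR (lam * (th - 8)) - 1) * W.
Proof.
move=> th8 Hth; rewrite mulr_sumr.
have e0 : 0 <= expR (lam * (th - 8)) - 1 by rewrite -psiE ?psi_ge0.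
rewrite (sum_split_sel (fun j => _ * _)) -[leLHS]add0r; apply: lerD.
  by apply: sumr_ge0 => j _; apply: mulr_ge0 => //; exact: counter'_ge0.
apply: ler_sum => j jS; rewrite fill_removed (negbTE jS).
have [f8|f8] := leP (fill st j) 8; first by rewrite psi_eq0 // mulr_ge0 ?counter'_ge0.
rewrite counter_removed (negbTE jS) -[leLHS]mulr1; apply: ler_pM => //.
- exact: psi_ge0.
- by rewrite -psiE // psi_homo // Hth.
- by apply: counter_big; lra.
Qed.

Lemma potential_step :
  \sum_j psi lam (fill st' j) <=
    (\sum_j psi lam (f j)) / (1 + kap / Num.max 1 W) + 2 * W.
Proof.
have d0 := delta_gt0; have d1 := delta_lt1; have e0 := eps_gt0; have e2 := eps_le.
have ep := epsp; have l0 := lam_ge0; have l1 := lam_le; have k0 := kap_ge0.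
have W0 := W_ge0.
set G := Num.max 1 W; set Phi := \sum_j psi lam (f j).
have G1 : 1 <= G by rewrite le_max lexx.
have GW : W <= G by rewrite le_max lexx orbT.
have G0 : 0 < G by lra.
set rho := kap / G.
have rho0 : 0 <= rho by rewrite divr_ge0 // ltW.
have rhok : rho <= kap by rewrite ler_pdivrMr // ler_peMr.
rewrite sum_split_sel.
set PS := \sum_(j in S) _; set PU := \sum_(j | _) _.
have PS0 : 0 <= PS by apply: sumr_ge0 => j _; apply: psi_ge0.
have PU0 : 0 <= PU by apply: sumr_ge0 => j _; apply: psi_ge0.
have PhiS : \sum_(j in S) psi lam (f j) <= Phi.
  by rewrite /Phi sum_split_sel lerDl sumr_ge0 // => j _; apply: psi_ge0.
have HPS : (1 + kap) * PS <= \sum_(j in S) psi lam (f j).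
  by rewrite mulr_sumr; apply: ler_sum => j jS; apply: psi_selected.
have easy : PU <= 2 * W -> PS + PU <= Phi / (1 + rho) + 2 * W.
  move=> h; apply: lerD => //; rewrite ler_pdivlMr ?ltr_wpDr //.
  have : PS * rho <= PS * kap by rewrite ler_wpM2l.
  by lra.
have [l0' /andP[l0S l08]|nobig] := pickP (fun l => (l \notin S) && (8 <= fill st l)); last first.
  apply: easy; rewrite /PU big1 ?mulr_ge0 // => j jS.
  rewrite psi_eq0 // fill_removed (negbTE jS).
  by have := nobig j; rewrite jS /= leNgt => /negbFE/ltW.
case: (@arg_maxP _ _ _ l0' (fun l => (l \notin S) && (8 <= fill st l)) (fill st)) => /=.
  by rewrite l0S.
move=> l /andP[lS l8] lmax.
set th := fill st l in l8 lmax.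
have thmax j : j \notin S -> fill st j <= th.
  move=> jS; have [j8|/ltW j8] := leP 8 (fill st j); first by apply: lmax; rewrite jS.
  exact: le_trans j8 l8.
have HPU := psi_unselected_le l8 thmax; rewrite -/PU in HPU.
set Th := expR (lam * (th - 8)) in HPU.
have [th12|th12] := ltP th 12.
  apply: easy; apply: (le_trans HPU); rewrite ler_wpM2r //.
  have h : lam * (th - 8) <= lam * 4 by rewrite ler_wpM2l //; lra.
  have : Th <= 1 + (lam * (th - 8)) + (lam * (th - 8)) ^+ 2.
    by apply: expR_quadratic; lra.
  have h0 : 0 <= lam * (th - 8) by rewrite mulr_ge0 //; lra.
  have : (lam * (th - 8)) ^+ 2 <= 1 by rewrite expr_le1 //; lra.
  lra.
have wl : 1 + delta <= counter st l by apply: counter_big; rewrite -/th; lra.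
have Scard : #|S| = p.+1.
  by apply: (selected_full sel lS); rewrite gt_eqF //; lra.
have Th0 : 0 < Th := expR_gt0 _.
pose E j := expR (lam * (f j - 8)).
have LT0 : 0 <= lam * Th := mulr_ge0 l0 (ltW Th0).
have stepS j : j \in S -> psi lam (fill st' j) + lam * delta * E j
    + lam * Th * (1 - 4 * lam) * (1 - c j) <= psi lam (f j).
  move=> jS; have [_ fj] := selected_above sel lS wl jS; rewrite -/th in fj.
  rewrite (fill_sel jS (le_trans _ (le_trans th12 fj))) ?ler_nat //.
  rewrite fillE in fj; have d01 : 0 <= delta <= 1 by rewrite !ltW.
  exact: (psi_drop l0 l1 d01 (c01 j) th12 fj).
have stepU j : j \notin S -> psi lam (fill st' j) - lam * Th * c j <= psi lam (f j).
  move=> jS; rewrite fill_removed (negbTE jS) fillE.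
  have fth := thmax j jS; rewrite fillE in fth; have /andP[cj0 _] := c01 j.
  exact: (psi_rise l0 cj0 fth).
set SE := \sum_(j in S) E j; set cS := \sum_(j in S) c j.
set cU := \sum_(j | j \notin S) c j.
have cSU : cS + cU <= (1 - eps) * p%:R by rewrite -sum_split_sel.
have cS0 : 0 <= cS by apply: sumr_ge0 => j _; have /andP[] := c01 j.
have totS : PS + lam * delta * SE + lam * Th * (1 - 4 * lam) * (p.+1%:R - cS)
   <= \sum_(j in S) psi lam (f j).
  have -> : p.+1%:R - cS = \sum_(j in S) (1 - c j).
    by rewrite sumrB sumr_const Scard.
  by rewrite /SE !mulr_sumr -!big_split; apply: ler_sum.
have totU : PU - lam * Th * cU <= \sum_(j | j \notin S) psi lam (f j).
  by rewrite /PU /cU mulr_sumr -sumrB; apply: ler_sum.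
have tot : PS + PU + lam * delta * SE + lam * Th * (eps * p%:R / 2) <= Phi.
  have -> : Phi = \sum_(j in S) psi lam (f j) + \sum_(j | j \notin S) psi lam (f j).
    exact: sum_split_sel.
  have B : eps * p%:R / 2 <= (1 - 4 * lam) * (p.+1%:R - cS) - cU.
    have h4 : 0 <= 4 * lam * cS by rewrite mulr_ge0 // mulr_ge0.
    have -> : (1 - 4 * lam) * (p.+1%:R - cS) =
      p.+1%:R - cS - 4 * lam * p.+1%:R + 4 * lam * cS by ring.
    have -> : 4 * lam * p.+1%:R = (eps * p%:R + eps) / 4 :> R.
      by rewrite /lam -natr1; field.
    by rewrite -[p.+1%:R]natr1; lra.
  have : lam * Th * (eps * p%:R / 2) <=
     lam * Th * ((1 - 4 * lam) * (p.+1%:R - cS) - cU).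
    by rewrite ler_wpM2l // mulr_ge0 // ltW.
  lra.
suff h : (PS + PU) * (1 + rho) <= Phi.
  have : PS + PU <= Phi / (1 + rho) by rewrite ler_pdivlMr // ltr_wpDr.
  lra.
have r1 : rho * PS <= lam * delta * SE.
  have : PS <= SE.
    apply: (@le_trans _ _ (\sum_(j in S) psi lam (f j))).
      have : 0 <= kap * PS by rewrite mulr_ge0.
      lra.
    apply: ler_sum => j jS; have [_ fj] := selected_above sel lS wl jS.
    rewrite -/th in fj; have /andP[cj0 cj1] := c01 j; have fe := fillE j.
    by rewrite psiE /E; lra.
  move=> PSE; apply: (@le_trans _ _ (kap * PS)); first by rewrite ler_wpM2r.
  apply: (@le_trans _ _ (lam * delta * PS)); last by rewrite ler_wpM2l // mulr_ge0 // ltW.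
  rewrite ler_wpM2r // kapE; have : 0 <= lam * delta by rewrite mulr_ge0 // ltW.
  lra.
have r2 : rho * PU <= lam * Th * (eps * p%:R / 2).
  have PUG : PU <= Th * G.
    have : (Th - 1) * W <= Th * W by rewrite ler_wpM2r //; lra.
    have : Th * W <= Th * G by rewrite ler_wpM2l // ltW.
    lra.
  apply: (@le_trans _ _ (rho * (Th * G))); first by rewrite ler_wpM2l.
  have -> : rho * (Th * G) = kap * Th by rewrite /rho; field; rewrite gt_eqF.
  have ep1 : 0 <= eps * p%:R - 1 by rewrite subr_ge0.
  have dd : 0 <= 1 - delta by rewrite subr_ge0 ltW.
  have := mulr_ge0 LT0 ep1; have := mulr_ge0 LT0 dd.
  rewrite kapE; lra.
lra.
Qed.

End PotentialStep.

(** * Threshold crossings and runs *)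

Lemma sum_unique (K : finType) (A : pred K) :
  (forall x y, A x -> A y -> x = y) -> (\sum_x A x)%N = [exists x, A x] :> nat.
Proof.
move=> uA; have [[x Ax]|nA] := pselect (exists x, A x).
  have -> : [exists x, A x] by apply/existsP; exists x.
  rewrite (bigD1 x) //= Ax big1 // => y; case: (boolP (A y)) => // Ay.
  by rewrite (uA _ _ Ay Ax) eqxx.
have -> : [exists x, A x] = false by apply/negbTE/existsP.
by rewrite big1 // => x _; case: (boolP (A x)) => // Ax; case: nA; exists x.
Qed.

Section Crossings.
Context {R : realType} {n : nat} (D L p : nat) (eps : R) (c : filler R n).
Hypothesis D_gt0 : (0 < D)%N.
Hypothesis c_ok : filler_ok p eps c.

Lemma poured0 j : poured c 0 j = 0.
Proof. by rewrite /poured big_geq. Qed.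

Lemma pouredS v j : poured c v.+1 j = poured c v j + c v.+1 j.
Proof. by rewrite /poured big_nat_recr. Qed.

Lemma poured_step v j : poured c v.-1 j <= poured c v j <= poured c v.-1 j + 1.
Proof.
case: v => [|v] /=; first by rewrite lexx lerDl ler01.
have [h _] := c_ok (ltn0Sn v); rewrite pouredS lerDl lerD2l; exact: h.
Qed.

Lemma poured_le v j : poured c v j <= v%:R.
Proof.
elim: v => [|v IH]; first by rewrite poured0.
by have := poured_step v.+1 j; rewrite /= -natr1 => /andP[_]; lra.
Qed.

Lemma poured_homo j v v' : (v <= v')%N -> poured c v j <= poured c v' j.
Proof.
elim: v' => [|v' IH]; first by rewrite leqn0 => /eqP ->.
rewrite leq_eqVlt => /predU1P[->//|/IH h]; apply: (le_trans h).
by have /andP[] := poured_step v'.+1 j.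
Qed.

Definition threshold (m t : nat) (x : R) : R := (m * D.+1 + t.+2)%:R + x.

Definition hit j m v t x := poured c v.-1 j < threshold m t x <= poured c v j.

Definition hits j m x : {set 'I_L.+1} := [set v : 'I_L.+1 | [exists t : 'I_D, hit j m v t x]].

Lemma threshold_sep m m' t t' (x x' : R) : (m < m')%N -> (t < D)%N -> 0 < x' -> x <= 1 ->
  threshold m t x + 1 < threshold m' t' x'.
Proof.
move=> mm tD x0 x1; rewrite /threshold.
have : (m * D.+1 + t.+2)%:R + 2 <= (m' * D.+1 + t'.+2)%:R :> R.
  by rewrite -natrD ler_nat; nia.
lra.
Qed.

Lemma threshold_sep_eq m t t' (x : R) : (t < t')%N -> threshold m t x + 1 <= threshold m t' x.
Proof.
move=> tt; rewrite /threshold addrAC lerD2r natr1 ler_nat; lia.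
Qed.

Lemma hit_inj (m m' t t' v : nat) (x x' : R) j : 0 < x <= 1 -> 0 < x' <= 1 ->
  (m = m' -> x = x') -> (t < D)%N -> (t' < D)%N ->
  hit j m v t x -> hit j m' v t' x' -> m = m' /\ t = t'.
Proof.
move=> /andP[x0 x1] /andP[x0' x1'] xx tD tD' /andP[h1 h2] /andP[h3 h4].
have /andP[_ st] := poured_step v j.
have [mm|mm|mm] := ltngtP m m'.
- exfalso; have := threshold_sep t' mm tD x0' x1; lra.
- exfalso; have := threshold_sep t mm tD' x0 x1'; lra.
- split=> //; rewrite -mm -xx // in h3 h4.
  have [tt|tt|//] := ltngtP t t'.
    by exfalso; have := threshold_sep_eq m x tt; lra.
  by exfalso; have := threshold_sep_eq m x tt; lra.
Qed.

Lemma hits_card j m (x : R) : 0 < x <= 1 -> (#|hits j m x| <= D)%N.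
Proof.
move=> x01; rewrite -sum1_card.
have -> : (\sum_(v in hits j m x) 1 = \sum_(v < L.+1) \sum_(t < D) hit j m v t x)%N.
  rewrite big_mkcond; apply: eq_bigr => v _; rewrite inE sum_unique; first by case: existsP.
  move=> t t' h h'; apply: val_inj.
  by have [] := hit_inj x01 x01 (fun _ => erefl) (ltn_ord t) (ltn_ord t') h h'.
rewrite exchange_big /= -[leqRHS]card_ord -sum1_card; apply: leq_sum => t _.
rewrite sum_unique; first by case: [exists _, _].
move=> v v' /andP[h1 h2] /andP[h3 h4]; apply: val_inj.
have [vv|vv|//] := ltngtP v v'.
  exfalso; have : poured c v j <= poured c v'.-1 j by apply: poured_homo; lia.
  lra.
exfalso; have : poured c v' j <= poured c v.-1 j by apply: poured_homo; lia.
lra.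
Qed.

Lemma sum_hit_telescope j m t (x : R) V : 0 < x ->
  (\sum_(1 <= v < V.+1) (hit j m v t x : nat)) = (threshold m t x <= poured c V j) :> nat.
Proof.
move=> x0; elim: V => [|V IH].
  rewrite big_geq // poured0 /threshold leNgt.
  by rewrite (_ : 0 < _) // ltr_wpDl.
rewrite big_nat_recr //= IH /hit /=.
have := poured_step V.+1 j => /= /andP[h _].
by case: leP => h1; case: leP => h2 //=; exfalso; lra.
Qed.

Variable s : 'I_n -> nat -> R.
Hypothesis s01 : forall j m, 0 < s j m <= 1.

Definition crosses j v : bool :=
  [exists m : 'I_L.+1, [exists t : 'I_D, hit j m v t (s j m)]].

Lemma sum_crosses j v :
  (\sum_(m < L.+1) \sum_(t < D) hit j m v t (s j m))%N = crosses j v.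
Proof.
rewrite /crosses -sum_unique.
  apply: eq_bigr => m _; rewrite sum_unique // => t t' h h'; apply: val_inj.
  by have [] := hit_inj (s01 j m) (s01 j m) (fun _ => erefl) (ltn_ord t) (ltn_ord t') h h'.
move=> m m' /existsP[t h] /existsP[t' h']; apply: val_inj.
by have [] := hit_inj (s01 j m) (s01 j m') (fun e => congr1 (s j) e) (ltn_ord t) (ltn_ord t') h h'.
Qed.

Lemma sum_hits_crosses j (v : 'I_L.+1) :
  (\sum_(m < L.+1) (v \in hits j m (s j m)))%N = crosses j v.
Proof.
rewrite -sum_crosses; apply: eq_bigr => m _; rewrite inE sum_unique // => t t' h h'.
apply: val_inj.
by have [] := hit_inj (s01 j m) (s01 j m) (fun _ => erefl) (ltn_ord t) (ltn_ord t') h h'.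
Qed.

Lemma counter_increment (delta : R) j v : (v <= L)%N ->
  \sum_(x \in crossed D s c v j) (1 + delta) = (1 + delta) * (crosses j v)%:R.
Proof.
move=> vL.
have thrE m t : (m * D.+1 + 1 + t.+1)%:R + s j m = threshold m t (s j m).
  by rewrite /threshold; congr (_%:R + _); lia.
case: (boolP (crosses j v)) => [/existsP[m /existsP[t ht]]|nc]; last first.
  rewrite mulr0 (_ : crossed D s c v j = set0) ?fsbig_set0 //.
  apply/seteqP; split=> // x [[m [[|t] [//= tD ->]]]]; rewrite thrE => h.
  move/negP: nc; apply; have mL : (m < L.+1)%N.
    have /andP[_ h2] := h; have := le_trans h2 (poured_le v j).
    have /andP[s0 _] := s01 j m.
    rewrite /threshold => h3.
    have : (m * D.+1 + t.+2)%:R < L%:R :> R.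
      by apply: lt_le_trans (_ : v%:R <= _); [lra|rewrite ler_nat].
    by rewrite ltr_nat; nia.
  by apply/existsP; exists (Ordinal mL); apply/existsP; exists (Ordinal tD).
rewrite mulr1 (_ : crossed D s c v j = [set threshold m t (s j m)]) ?fsbig_set1 //.
apply/seteqP; split=> x.
  move=> [[m' [[|t'] [//= tD ->]]]]; rewrite thrE => h.
  by have [<- <-] := hit_inj (s01 j m) (s01 j m') (fun e => congr1 (s j) e) (ltn_ord t) tD ht h.
move=> ->; split; last exact: ht.
by exists m, t.+1; split; [rewrite ltn_ord|rewrite thrE].
Qed.

Lemma crosses_lower_bound j V : (V <= L)%N ->
  poured c V j - 3 <= (1 + D%:R^-1) * (\sum_(1 <= v < V.+1) crosses j v)%:R.
Proof.
move=> VL; set a := poured c V j.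
have -> : (\sum_(1 <= v < V.+1) crosses j v)%N =
    (\sum_(m < L.+1) \sum_(t < D) (threshold m t (s j m) <= a)%R)%N.
  under eq_bigr do rewrite -sum_crosses.
  rewrite exchange_big; apply: eq_bigr => m _; rewrite exchange_big.
  apply: eq_bigr => t _; rewrite sum_hit_telescope //.
  by have /andP[] := s01 j m.
have aL : a <= L%:R by rewrite (le_trans (poured_le V j)) // ler_nat.
apply: (@le_trans _ _ (clamp (L.+1%:R * D.+1%:R) (a - 3))).
  rewrite /clamp le_max le_min lexx /=; apply/orP; right.
  have : L%:R <= L.+1%:R * D.+1%:R :> R by rewrite -natrM ler_nat; nia.
  lra.
rewrite -sum_clamp // natr_sum mulr_sumr big_mkord; apply: ler_sum => m _.
apply: le_trans (clamp_scale _ D_gt0) _.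
have i0 : 0 <= 1 + D%:R^-1 :> R by rewrite addr_ge0 // invr_ge0.
rewrite ler_wpM2l // -[D%:R]mulr1 -sum_clamp // natr_sum big_mkord.
apply: ler_sum => t _; rewrite mulr1 /threshold.
have /andP[_ s1] := s01 j m.
case: (leP (_ + s j m) a) => h; first exact: (clamp_le _ ler01).
rewrite /clamp ge_max lexx ge_min; apply/orP; right.
have e : (m * D.+1 + t.+2)%:R = m%:R * D.+1%:R + t%:R + 2 :> R.
  by rewrite -addn2 !natrD natrM addrA.
by rewrite /= ; move: h; rewrite e; lra.
Qed.

End Crossings.

Section Run.
Context {R : realType} {n : nat} (p D L : nat) (eps delta : R).
Context (c : filler R n) (s : 'I_n -> nat -> R) (rule : selection_rule R n).
Hypotheses (eps_gt0 : 0 < eps) (eps_le : eps <= 2^-1) (epsp : 1 <= eps * p%:R).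
Hypotheses (delta_gt0 : 0 < delta) (delta_lt1 : delta < 1).
Hypothesis deltaV : delta^-1 = D%:R.
Hypothesis c_ok : filler_ok p eps c.
Hypothesis s01 : forall j m, 0 < s j m <= 1.
Hypothesis rule_ok : smoothed_greedy_rule p delta rule.

Let st v := run D delta rule s c v.
Let st_poured v := pour D delta s c v.+1 (st v).

Definition total_counter v : R := \sum_j counter (run D delta rule s c v) j.
Definition potential v : R :=
  \sum_j psi (eps / 16) (fill (run D delta rule s c v) j).
Definition excess v : R :=
  Num.max 0 (\sum_j (crosses D L c s j v)%:R - p%:R).

Let D_gt0 : (0 < D)%N.
Proof. by rewrite -(ltr_nat R) -deltaV invr_gt0. Qed.

Let deltaE : delta = D%:R^-1.
Proof. by rewrite -deltaV invrK. Qed.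

Let run_step v : st v.+1 = remove delta (rule v.+1 (st_poured v)) (st_poured v).
Proof. by []. Qed.

Let poured_counter v j : (v < L)%N ->
  counter (st_poured v) j = counter (st v) j + (1 + delta) * (crosses D L c s j v.+1)%:R.
Proof. by move=> vL; rewrite /= (counter_increment (L := L) D_gt0 c_ok s01). Qed.

Let delta_mul : 1 + delta = D.+1%:R * delta.
Proof. by rewrite -natr1 mulrDl mul1r {2}deltaE divff // pnatr_eq0 -lt0n. Qed.

Lemma counter_discrete v j : (v <= L)%N ->
  exists N : nat, counter (run D delta rule s c v) j = N%:R * delta.
Proof.
elim: v => [|v IH] vL; first by exists 0%N; rewrite mul0r.
have [N HN] := IH (ltnW vL).
have [M HM] : exists M : nat, counter (st_poured v) j = M%:R * delta.
  exists (N + D.+1 * crosses D L c s j v.+1)%N.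
  by rewrite poured_counter // HN delta_mul natrD natrM; ring.
rewrite -/(st v.+1) run_step counter_removed; case: ifP => _; last by exists M.
exists (M - D.+2)%N; rewrite HM.
have -> : 1 + 2 * delta = D.+2%:R * delta.
  by rewrite -[D.+2%:R]natr1 [RHS]mulrDl -delta_mul; ring.
rewrite -mulrBl; have [h|/ltnW h] := leqP D.+2 M.
  by rewrite max_r ?natrB // mulr_ge0 ?subr_ge0 ?ler_nat // ltW.
move: (h); rewrite -subn_eq0 => /eqP ->; rewrite mul0r max_l //.
by rewrite mulr_le0_ge0 ?subr_le0 ?ler_nat // ltW.
Qed.

Let counter_ge0 v j : (v <= L)%N -> 0 <= counter (st v) j.
Proof. by move=> /(counter_discrete j)[N ->]; rewrite mulr_ge0 // ltW. Qed.

Let counter_dichotomy v j : (v <= L)%N -> counter (st v) j = 0 \/ delta <= counter (st v) j.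
Proof.
move=> /(counter_discrete j)[[|N] ->]; [left; exact: mul0r|right].
by rewrite ler_peMl ?(ltW delta_gt0) // ler1n.
Qed.

Let counter_poured_ge0 v j : (v < L)%N -> 0 <= counter (st_poured v) j.
Proof.
move=> vL; rewrite poured_counter // addr_ge0 ?counter_ge0 ?(ltnW vL) //.
by rewrite mulr_ge0 // addr_ge0 // ltW.
Qed.

Let fill_counter v j : (v <= L)%N -> fill (st v) j - counter (st v) j =
   poured c v j - (1 + delta) * (\sum_(1 <= h < v.+1) crosses D L c s j h)%:R.
Proof.
elim: v => [|v IH] vL; first by rewrite !big_geq // mulr0 !subr0 poured0.
rewrite big_nat_recr //= natrD pouredS.
have := poured_counter j vL; rewrite /= => ->.
by have := IH (ltnW vL); lra.
Qed.

Lemma fill_le_counter v j : (v <= L)%N ->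
  fill (run D delta rule s c v) j <= counter (run D delta rule s c v) j + 3.
Proof.
move=> vL; have := fill_counter j vL.
have := crosses_lower_bound D_gt0 c_ok s01 j vL.
by rewrite -deltaE; lra.
Qed.

Lemma total_counter_rec v : (v < L)%N ->
  total_counter v.+1 <= Num.max 0 (total_counter v - delta + 3 * excess v.+1).
Proof.
move=> vL; apply: (total_counter_step delta_gt0 delta_lt1 (rule_ok v.+1 (st_poured v))).
- by move=> j; exact: poured_counter.
- by move=> j; apply: counter_dichotomy; exact: ltnW.
Qed.

Lemma potential_rec v : (v < L)%N ->
  potential v.+1 <=
    potential v / (1 + eps * delta / 32 / Num.max 1 (total_counter v.+1))
      + 2 * total_counter v.+1.
Proof.
move=> vL.
have [c01 sum_c] := c_ok (ltn0Sn v).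
apply: (potential_step eps_gt0 eps_le epsp delta_gt0 delta_lt1
  (rule_ok v.+1 (st_poured v)) (c := c v.+1)) => //.
- by move=> j; exact: counter_poured_ge0.
- move=> j; have := fill_le_counter j vL.
  rewrite -/(st v.+1) run_step fill_removed counter_removed.
  case: ifP => // _; rewrite /Order.max /Order.min.
  by repeat case: ifPn => //; rewrite -?leNgt => *; lra.
Qed.

End Run.

Lemma lindley_bound (R : realDomainType) (W z : nat -> R) (L u : nat) :
  W 0%N <= 0 ->
  (forall v, (v < L)%N -> W v.+1 <= Num.max 0 (W v + z v.+1)) -> (u <= L)%N ->
  exists2 T, (T <= u)%N & W u <= \sum_(u - T <= v < u) z v.+1.
Proof.
move=> W0 Wrec; elim: u => [|u IH] uL; first by exists 0%N => //; rewrite big_geq.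
have [T Tu WT] := IH (ltnW uL); have := Wrec u uL; rewrite le_max => /orP[h|h].
  by exists 0%N => //; rewrite subn0 big_geq.
exists T.+1 => //; apply: (le_trans h); rewrite subSS big_nat_recr ?leq_subr //=.
by rewrite lerD2r.
Qed.

(* [M * (x ^+ 2 + (t - u))] with [M = 8 / kap] is a supersolution of the
   recursion as soon as [W u] is at most [sqrt (x ^+ 2 + (t - u))]. *)
Lemma potential_bound (R : rcfType) (Phi W : nat -> R) (kap x : R) (t u : nat) :
  0 < kap <= 1 -> 1 <= x -> 2 <= kap * x -> Phi 0%N <= 0 ->
  (forall v, 0 <= Phi v) ->
  (forall v, (v < t)%N ->
     Phi v.+1 <= Phi v / (1 + kap / Num.max 1 (W v.+1)) + 2 * W v.+1) ->
  (forall v, (v <= t)%N -> W v <= Num.sqrt (x ^+ 2 + (t - v)%:R)) ->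
  (u <= t)%N -> Phi u <= 8 / kap * (x ^+ 2 + (t - u)%:R).
Proof.
move=> /andP[k0 k1] x1 kx Phi0 Phi_ge0 rec HW; elim: u => [|u IH] ut.
  apply: (le_trans Phi0); rewrite mulr_ge0 ?divr_ge0 ?(ltW k0) //.
  by rewrite addr_ge0 ?sqr_ge0.
apply: (le_trans (rec u ut)).
have {}IH := IH (ltnW ut); have {}HW := HW _ ut.
have tE : (t - u)%:R = (t - u.+1)%:R + 1 :> R by rewrite natr1; congr _%:R; lia.
move: HW IH; rewrite tE; set a := (t - u.+1)%:R; set y := Num.sqrt _ => HW IH.
have a0 : 0 <= a by apply: ler0n.
have x2 : 0 <= x ^+ 2 + a by rewrite addr_ge0 // sqr_ge0.
have yE : y ^+ 2 = x ^+ 2 + a by rewrite sqr_sqrtr.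
have y0 : 0 <= y by apply: sqrtr_ge0.
have xy : x <= y by rewrite -ler_sqr ?nnegrE ?yE ?lerDl //; lra.
set M := 8 / kap; have M0 : 0 < M by rewrite divr_gt0.
have Mk : M * kap = 8 by rewrite /M divfK // gt_eqF.
rewrite -yE; apply: (@le_trans _ _ (M * (y ^+ 2 + 1) / (1 + kap / y) + 2 * y)).
  apply: lerD; last by rewrite ler_wpM2l.
  have G1 : 1 <= Num.max 1 (W u.+1) by rewrite le_max lexx.
  have Gy : Num.max 1 (W u.+1) <= y by rewrite ge_max HW andbT; lra.
  apply: ler_pM => //.
  - by rewrite invr_ge0 addr_ge0 // divr_ge0 ?(ltW k0) //; lra.
  - by apply: (le_trans IH); rewrite ler_wpM2l ?(ltW M0) // yE addrA.
  - have y1 : 0 < y by lra.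
    rewrite lef_pV2 ?posrE ?lerD2l ?ler_wpM2l ?lef_pV2 ?posrE ?(ltW k0) //;
      by rewrite ?addr_gt0 ?divr_gt0 //; lra.
have y1 : 0 < y by lra.
have ky : 0 < kap / y by rewrite divr_gt0.
rewrite -lerBrDr ler_pdivrMr ?addr_gt0 //.
have -> : (M * y ^+ 2 - 2 * y) * (1 + kap / y) =
    M * y ^+ 2 + M * kap * y - 2 * y - 2 * kap by field; rewrite gt_eqF.
have : M * 2 <= M * (kap * y).
  by rewrite ler_wpM2l ?(ltW M0) // (le_trans kx) // ler_wpM2l // ltW.
rewrite mulrA Mk; lra.
Qed.

Section Pathwise.
Context {R : realType} {n p : nat} {D L : nat} {eps delta : R}.
Context {c : filler R n} {s : 'I_n -> nat -> R} {rule : selection_rule R n}.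
Hypotheses (eps_gt0 : 0 < eps) (eps_le : eps <= 2^-1) (epsp : 1 <= eps * p%:R).
Hypotheses (delta_gt0 : 0 < delta) (delta_lt1 : delta < 1).
Hypothesis deltaV : delta^-1 = D%:R.
Hypothesis c_ok : filler_ok p eps c.
Hypothesis s01 : forall j m, 0 < s j m <= 1.
Hypothesis rule_ok : smoothed_greedy_rule p delta rule.
Variable x : R.
Hypotheses (x_ge1 : 1 <= x) (kx : 2 <= eps * delta / 32 * x).
Hypothesis few_excess : forall u T : nat, (T <= u)%N -> (u <= L)%N ->
  \sum_(u - T <= v < u) excess p D L c s v.+1 <=
    (Num.sqrt (x ^+ 2 + (L - u)%:R) + delta * T%:R) / 3.

Lemma expR_fill_le j :
  expR (eps / 16 * (fill (run D delta rule s c L) j - 8)) <=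
    1 + 8 / (eps * delta / 32) * x ^+ 2.
Proof.
have d0 := delta_gt0; have d1 := delta_lt1; have e0 := eps_gt0; have e2 := eps_le.
have l0 : 0 <= eps / 16 by lra.
have ed0 : 0 < eps * delta by rewrite mulr_gt0.
have ed1 : eps * delta <= eps by rewrite ler_piMr ?(ltW e0) ?(ltW d1).
have init : run D delta rule s c 0 = empty_state by [].
have HW u : (u <= L)%N ->
    total_counter D delta c s rule u <=
      Num.sqrt (x ^+ 2 + (L - u)%:R).
  move=> uL.
  have [||T Tu] := @lindley_bound _ (total_counter D delta c s rule)
    (fun v => 3 * excess p D L c s v - delta) L u _ _ uL.
  - by rewrite /total_counter init big1.
  - move=> v vL; apply: le_trans (total_counter_rec delta_gt0 delta_lt1 deltaV c_ok
      s01 rule_ok vL) _.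
    by rewrite addrAC -addrA [3 * _ - _]addrC addrA.
  move=> h; apply: (le_trans h); rewrite sumrB -mulr_sumr sumr_const_nat subKn //.
  by have := few_excess Tu uL; rewrite -[delta *+ T]mulr_natr; lra.
have := @potential_bound _ (potential D eps delta c s rule)
  (total_counter D delta c s rule) (eps * delta / 32) x L L _ x_ge1 kx _ _ _ HW (leqnn L).
rewrite subnn addr0 => H.
have {}H : potential D eps delta c s rule L <= 8 / (eps * delta / 32) * x ^+ 2.
  apply: H.
  - by lra.
  - by rewrite /potential init big1 // => i _; rewrite psi_eq0.
  - by move=> v; apply: sumr_ge0 => i _; exact: psi_ge0.
  - move=> v vL; exact: (potential_rec eps_gt0 eps_le epsp delta_gt0 delta_lt1
      deltaV c_ok s01 rule_ok vL).
have := psi_geE l0 (fill (run D delta rule s c L) j).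
have : psi (eps / 16) (fill (run D delta rule s c L) j) <=
    potential D eps delta c s rule L.
  rewrite /potential (bigD1 j) //= lerDl; apply: sumr_ge0 => i _; exact: psi_ge0.
lra.
Qed.

End Pathwise.

(** * Concentration of the excess *)

Section Series.
Context {R : realType}.

Lemma expRN_le (m : nat) (z : R) : 0 < z -> expR (- z) <= m.+1`!%:R / z ^+ m.+1.
Proof.
move=> z0; have a0 : 0 < z ^+ m.+1 / m.+1`!%:R.
  by rewrite divr_gt0 ?exprn_gt0 // ltr0n fact_gt0.
rewrite expRN -[leRHS]invf_div lef_pV2 ?posrE ?expR_gt0 //.
by apply: le_trans (expR_ge1Dxn m (ltW z0)); rewrite lerDr.
Qed.

Lemma sum_inv_sqr_le m : \sum_(0 <= i < m) (i.+1%:R ^+ 2)^-1 <= 2 :> R.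
Proof.
have key k : \sum_(0 <= i < k.+1) (i.+1%:R ^+ 2)^-1 <= 2 - k.+1%:R^-1 :> R.
  elim: k => [|k IH]; first by rewrite big_nat1 expr1n invr1; lra.
  rewrite big_nat_recr //=; apply: (le_trans (lerD IH (lexx _))).
  set a : R := k.+1%:R; have -> : k.+2%:R = a + 1 :> R by rewrite natr1.
  have a0 : 0 < a by rewrite ltr0n.
  have b0 : 0 < a + 1 by rewrite addr_gt0.
  rewrite -subr_ge0.
  have -> : 2 - (a + 1)^-1 - (2 - a^-1 + ((a + 1) ^+ 2)^-1) = (a * (a + 1) ^+ 2)^-1.
    by field; rewrite !gt_eqF.
  by rewrite invr_ge0 mulr_ge0 ?sqr_ge0 // ltW.
case: m => [|m]; first by rewrite big_geq.
by apply: (le_trans (key m)); rewrite lerBlDr lerDl invr_ge0.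
Qed.

Lemma sum_expR_linear (b : R) m : 0 < b <= 4^-1 ->
  \sum_(0 <= i < m) expR (- (b * i%:R)) <= 8 / b ^+ 2.
Proof.
move=> /andP[b0 b4].
have -> : 8 / b ^+ 2 = 4 / b ^+ 2 * 2 by ring.
apply: le_trans (ler_wpM2l _ (sum_inv_sqr_le m)); last by rewrite divr_ge0 ?sqr_ge0.
rewrite mulr_sumr; apply: ler_sum => i _.
have i0 : 0 < i.+1%:R :> R by rewrite ltr0n.
have -> : expR (- (b * i%:R)) = expR b * expR (- (b * i.+1%:R)).
  by rewrite -expRD -natr1; congr expR; ring.
have eb : expR b <= 2.
  apply: (le_trans (expR_quadratic b4)).
  have : b ^+ 2 <= b * 4^-1 by rewrite expr2 ler_wpM2l // ltW.
  lra.
apply: (le_trans (ler_pM (expR_ge0 _) (expR_ge0 _) eb (expRN_le 1 (mulr_gt0 b0 i0)))).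
rewrite exprMn invfM (_ : 2`! = 2)%N //.
rewrite le_eqVlt; apply/orP; left; apply/eqP; ring.
Qed.

Lemma sum_expR_sqrt (a x : R) m : 0 < a -> 1 <= x ->
  \sum_(0 <= i < m) expR (- (a * Num.sqrt (x ^+ 2 + i%:R))) <=
    768 / a ^+ 4 * expR (- (a * x / 2)).
Proof.
move=> a0 x1.
have -> : 768 / a ^+ 4 * expR (- (a * x / 2)) =
   384 / a ^+ 4 * expR (- (a * x / 2)) * 2 by ring.
have c0 : 0 <= 384 / a ^+ 4 := divr_ge0 (ler0n R 384) (exprn_ge0 4 (ltW a0)).
apply: le_trans (ler_wpM2l (mulr_ge0 c0 (expR_ge0 _)) (sum_inv_sqr_le m)).
rewrite mulr_sumr; apply: ler_sum => i _.
have x2 : 1 <= x ^+ 2 by rewrite expr_ge1 //; lra.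
have i0 : 0 <= i%:R :> R by [].
have s0 : 0 <= x ^+ 2 + i%:R by lra.
set y := Num.sqrt _; have yE : y ^+ 2 = x ^+ 2 + i%:R by rewrite sqr_sqrtr.
have y0 : 0 <= y by apply: sqrtr_ge0.
have xy : x <= y by rewrite -ler_sqr ?nnegrE ?yE ?lerDl //; lra.
have yp : 0 < y by lra.
have -> : expR (- (a * y)) = expR (- (a * y / 2)) * expR (- (a * y / 2)).
  by rewrite -expRD; congr expR; lra.
have e1 : expR (- (a * y / 2)) <= expR (- (a * x / 2)).
  by rewrite ler_expR lerN2 ler_wpM2r ?invr_ge0 // ler_wpM2l // ltW.
have ay : 0 < a * y / 2 by rewrite divr_gt0 // mulr_gt0.
have e2 := expRN_le 3 ay.
have e3 : 4`!%:R / (a * y / 2) ^+ 4 <= 384 / a ^+ 4 * (i.+1%:R ^+ 2)^-1.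
  have -> : 4`!%:R / (a * y / 2) ^+ 4 = 384 / a ^+ 4 * ((x ^+ 2 + i%:R) ^+ 2)^-1.
    by rewrite -yE (_ : 4`! = 24)%N //; field; rewrite !gt_eqF.
  apply: (ler_wpM2l c0).
  have i1 : 0 < i.+1%:R :> R by rewrite ltr0n.
  rewrite lef_pV2 ?posrE ?exprn_gt0 //; last by lra.
  by rewrite lerXn2r ?nnegrE ?(ltW i1) // -natr1; lra.
have := ler_pM (expR_ge0 _) (expR_ge0 _) e1 (le_trans e2 e3).
by rewrite mulrA [_ * (384 / _)]mulrC.
Qed.

End Series.

Section ExcessTail.
Context {R : realType} {K : finType} (D L p : nat) (eps delta : R).
Local Notation Om := {set 'I_L.+1}.
Context (q : K -> Om -> R).
Hypothesis q_ge0 : forall k a, 0 <= q k a.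
Hypothesis q_sum1 : forall k, \sum_a q k a = 1.
Hypothesis q_mean : forall v : 'I_L.+1, (0 < v)%N ->
  \sum_k \sum_a q k a * (v \in a)%:R <= (1 - eps) * p%:R.
Hypothesis q_supp : forall k a, q k a != 0 -> (#|a| <= D)%N.
Hypotheses (eps_gt0 : 0 < eps) (eps_le : eps <= 2^-1).
Hypotheses (p_gt0 : (0 < p)%N) (D_gt0 : (0 < D)%N).
Hypothesis deltaV : delta^-1 = D%:R.

Let E (F : (K -> Om) -> R) : R := Ex q (index_enum K) F (fun=> finset.set0).

Definition total_crossings v (om : K -> Om) : R := \sum_k ((inord v : 'I_L.+1) \in om k)%:R.
Definition excess_of v om : R := Num.max 0 (total_crossings v om - p%:R).

Let E_coord k (g : Om -> R) : E (fun om => g (om k)) = \sum_a q k a * g a.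
Proof. by apply: Ex_coord => //; rewrite ?mem_index_enum ?index_enum_uniq. Qed.

Let bool_ge0 (b : bool) : 0 <= b%:R :> R. Proof. exact: ler0n. Qed.

Let dist_total_crossings k v (x y : K -> Om) : (forall l, l != k -> x l = y l) ->
  y k = finset.set0 ->
  total_crossings v x - total_crossings v y = ((inord v : 'I_L.+1) \in x k)%:R.
Proof.
move=> xy yk; rewrite /total_crossings (bigD1 k) // [X in _ - X](bigD1 k) //=.
rewrite yk inE add0r (eq_bigr (fun l => ((inord v : 'I_L.+1) \in y l)%:R)) ?addrK //.
by move=> l lk; rewrite xy.
Qed.

Let dist_excess k v (x y : K -> Om) : (forall l, l != k -> x l = y l) ->
  y k = finset.set0 -> `|excess_of v x - excess_of v y| <= ((inord v : 'I_L.+1) \in x k)%:R.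
Proof.
move=> xy yk; have := dist_total_crossings v xy yk; rewrite /excess_of.
have := bool_ge0 ((inord v : 'I_L.+1) \in x k); set b := _%:R => b0 e.
rewrite ler_norml /Order.max.
by repeat case: ifPn => //; rewrite -?leNgt => *; apply/andP; split; lra.
Qed.

Lemma mean_excess v : (0 < v <= L)%N ->
  E (excess_of v) <= 2 / eps * expR (- (eps ^+ 2 * p%:R / 4)).
Proof.
move=> /andP[v0 vL]; have e0 := eps_gt0; have e2 := eps_le.
set th := eps / 2; have th0 : 0 < th by rewrite /th; lra.
have iv : (inord v : 'I_L.+1) = v :> nat by rewrite inordK.
have mgf : E (fun om => expR (th * total_crossings v om)) <=
    expR ((th + th ^+ 2) * ((1 - eps) * p%:R)).
  apply: le_trans (Ex_expR_le q_ge0 q_sum1 (a0 := finset.set0)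
     (N := fun _ a => ((inord v : 'I_L.+1) \in a)%:R) (ltW th0) _ _ _ _) _.
  - by move=> k a _; case: (_ \in _); rewrite /= ?mulr0 ?mulr1 /th; lra.
  - exact: index_enum_uniq.
  - by move=> k x y xy yk; rewrite (dist_total_crossings v xy yk) ger0_norm.
  rewrite ler_expR -/(E _).
  have -> : E (total_crossings v) =
      \sum_k \sum_a q k a * ((inord v : 'I_L.+1) \in a)%:R.
    rewrite /E Ex_sum //; apply: eq_bigr => k _.
    exact: (E_coord k (fun a => ((inord v : 'I_L.+1) \in a)%:R)).
  have -> : \sum_k \sum_a q k a * ((inord v : 'I_L.+1) \in a)%:R ^+ 2 =
      \sum_k \sum_a q k a * ((inord v : 'I_L.+1) \in a)%:R.
    by do 2!apply: eq_bigr => ? _; case: (_ \in _); rewrite ?expr1n ?expr0n.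
  rewrite -mulrDl ler_wpM2l ?addr_ge0 ?sqr_ge0 ?(ltW th0) //.
  by apply: q_mean; rewrite iv.
apply: (@le_trans _ _ (E (fun om => (th^-1 * expR (- (th * p%:R))) *
    expR (th * total_crossings v om)))).
  apply: Ex_le => // om; rewrite -mulrA -expRD ge_max; apply/andP; split.
    by rewrite mulr_ge0 ?expR_ge0 // invr_ge0 ltW.
  rewrite ler_pdivlMl //.
  have := expR_ge1Dx (- (th * p%:R) + th * total_crossings v om); lra.
rewrite /E ExZ.
apply: le_trans (ler_wpM2l _ mgf) _.
  by rewrite mulr_ge0 ?expR_ge0 // invr_ge0 ltW.
rewrite -[leLHS]mulrA -expRD (_ : th^-1 = 2 / eps); last by rewrite /th invf_div.
rewrite ler_wpM2l ?divr_ge0 ?(ltW e0) // ler_expR /th.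
have : 0 <= eps ^+ 3 * p%:R by rewrite mulr_ge0 ?exprn_ge0 // ltW.
set P := p%:R; have -> : eps ^+ 3 * P = eps * eps * eps * P by ring.
by rewrite !expr2; lra.
Qed.

Let eta := delta ^+ 2 / (12 * p%:R).

Lemma excess_tail (T u : nat) (y : R) : (T <= u)%N -> (u <= L)%N ->
  (forall v, (0 < v <= L)%N -> E (excess_of v) <= delta / 12) ->
  E (fun om => ((y + delta * T%:R) / 3 < \sum_(u - T <= v < u) excess_of v.+1 om)%R%:R)
    <= expR (- (eta * y / 3)) * expR (- (eta * delta / 6 * T%:R)).
Proof.
move=> Tu uL mean; set Q := (y + _) / 3.
pose F om := \sum_(u - T <= v < u) excess_of v.+1 om.
pose N (k : K) (a : Om) : R := \sum_(u - T <= v < u) ((inord v.+1 : 'I_L.+1) \in a)%:R.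
have D0 : 0 < D%:R :> R by rewrite ltr0n.
have P0 : 0 < p%:R :> R by rewrite ltr0n.
have deltaE : delta = D%:R^-1 by rewrite -deltaV invrK.
have d0 : 0 < delta by rewrite deltaE invr_gt0.
have dD : delta * D%:R = 1 by rewrite deltaE mulVf // gt_eqF.
have eta0 : 0 < eta by rewrite divr_gt0 ?exprn_gt0 ?mulr_gt0.
have N0 k a : 0 <= N k a by apply: sumr_ge0.
have ND k a : q k a != 0 -> N k a <= D%:R.
  move=> qa; apply: (@le_trans _ _ #|a|%:R); last by rewrite ler_nat (q_supp qa).
  rewrite /N -natr_sum ler_nat -sum1_card [leqRHS]big_mkcond /=.
  pose f v : nat := (inord v : 'I_L.+1) \in a.
  have -> : (\sum_(i < L.+1) (if i \in a then 1 else 0) = \sum_(0 <= v < L.+1) f v)%N.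
    by rewrite big_mkord; apply: eq_bigr => i _; rewrite /f inord_val.
  rewrite -(big_add1 0%N addn (u - T) u.+1 xpredT f).
  rewrite [leqRHS](big_cat_nat (n := (u - T).+1)) //; last by lia.
  rewrite [X in (_ <= _ + X)%N](big_cat_nat (n := u.+1)) //; last by lia.
  by rewrite (leq_trans _ (leq_addl _ _)) // leq_addr.
have win v : (u - T <= v < u)%N -> (0 < v.+1 <= L)%N.
  by move=> /andP[_ vu] /=; apply: leq_trans vu uL.
have EF : E F <= T%:R * (delta / 12).
  rewrite /E Ex_sum // (@le_trans _ _ (\sum_(u - T <= v < u) delta / 12)) //.
    by rewrite big_nat [leRHS]big_nat; apply: ler_sum => v /win /mean.
  by rewrite sumr_const_nat subKn // mulr_natl.
have EN : \sum_k \sum_a q k a * N k a <= T%:R * p%:R.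
  under eq_bigr => k _ do under eq_bigr => a _ do rewrite mulr_sumr.
  under eq_bigr => k _ do rewrite exchange_big /=.
  rewrite exchange_big /= (@le_trans _ _ (\sum_(u - T <= v < u) p%:R)) //.
    rewrite big_nat [leRHS]big_nat; apply: ler_sum => v /win /andP[_ vL].
    apply: (@le_trans _ _ ((1 - eps) * p%:R)).
      by apply: q_mean; rewrite inordK.
    by rewrite ler_piMl ?(ltW P0) // lerBlDr lerDl ltW.
  by rewrite sumr_const_nat subKn // mulr_natl.
have V : \sum_k \sum_a q k a * N k a ^+ 2 <= D%:R * (T%:R * p%:R).
  apply: le_trans (ler_wpM2l (ltW D0) EN).
  rewrite mulr_sumr; apply: ler_sum => k _; rewrite mulr_sumr; apply: ler_sum => a _.
  have [->|qa] := eqVneq (q k a) 0; first by rewrite !mul0r mulr0.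
  by rewrite [leRHS]mulrCA ler_wpM2l // expr2 ler_wpM2r ?ND.
have etaD : eta * D%:R = delta / (12 * p%:R).
  have -> : eta * D%:R = (delta * D%:R) * delta / (12 * p%:R) by rewrite /eta; ring.
  by rewrite dD mul1r.
have mgf : E (fun om => expR (eta * F om)) <=
    expR (eta * (T%:R * (delta / 12)) + eta * (delta / 12 * T%:R)).
  apply: le_trans (Ex_expR_le q_ge0 q_sum1 (a0 := finset.set0) (N := N) (ltW eta0) _ _ _ _) _.
  - move=> k a qa; apply: (@le_trans _ _ (eta * D%:R)); first by rewrite ler_wpM2l ?(ltW eta0) ?ND.
    rewrite etaD ler_pdivrMr ?mulr_gt0 //.
    have : delta <= 1.
      by rewrite -dD ler_peMr ?(ltW d0) // ler1n.
    have : 1 <= p%:R :> R by rewrite ler1n.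
    lra.
  - exact: index_enum_uniq.
  - move=> k x z xz zk; rewrite /F -sumrB; apply: le_trans (ler_norm_sum _ _ _) _.
    by apply: ler_sum => v _; exact: dist_excess.
  rewrite ler_expR -/(E _); apply: lerD; first by rewrite ler_wpM2l ?(ltW eta0).
  rewrite expr2 -mulrA ler_wpM2l ?(ltW eta0) //.
  apply: (le_trans (ler_wpM2l (ltW eta0) V)).
  have -> : eta * (D%:R * (T%:R * p%:R)) = (eta * D%:R) * T%:R * p%:R by ring.
  rewrite etaD le_eqVlt; apply/orP; left; apply/eqP; field.
  by rewrite gt_eqF.
apply: (@le_trans _ _ (E (fun om => expR (- (eta * Q)) * expR (eta * F om)))).
  apply: Ex_le => // om; rewrite -expRD -/(F om).
  case: ltP => h /=; last exact: expR_ge0.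
  rewrite -expR0 ler_expR.
  have : 0 <= eta * (F om - Q) by rewrite mulr_ge0 ?(ltW eta0) // subr_ge0 ltW.
  lra.
rewrite /E ExZ; apply: le_trans (ler_wpM2l (expR_ge0 _) mgf) _.
rewrite -!expRD ler_expR /Q.
by rewrite le_eqVlt; apply/orP; left; apply/eqP; field.
Qed.

End ExcessTail.

Section UniformLaw.
Context {d : measure_display} {T : measurableType d} {R : realType}.
Context (P : probability T R).

Lemma uniform_itv_le (X : {RV P >-> R}) (x y : R) : uniform_on_unit X -> x <= y ->
  (P (X @^-1` [set` `]x, y]]) <= (clamp 1 y - clamp 1 x)%:E)%E.
Proof.
move=> [_ unif] xy.
have -> : P (X @^-1` [set` `]x, y]]) = uniform_prob (@ltr01 R) [set` `]x, y]].
  by rewrite -unif //; exact: measurable_itv.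
rewrite /uniform_prob integral_uniform_pdf.
rewrite (eq_integral (fun=> 1%:E)); last first.
  move=> z; rewrite inE => -[_ /=]; rewrite in_itv /= => z01.
  by rewrite /uniform_pdf z01 subr0 invr1.
rewrite integral_cst ?mul1e; last exact: measurableI.
apply: (@le_trans _ _ (lebesgue_measure [set` `[clamp 1 x, clamp 1 y]])).
  apply: le_measure; rewrite ?inE; [exact: measurableI|exact: measurable_itv|].
  move=> z [/=]; rewrite !in_itv /= => /andP[xz zy] z01.
  by rewrite -(clamp_id z01) !clamp_homo // ltW.
rewrite lebesgue_measure_itv /= lte_fin; case: ifP => // _.
by rewrite lee_fin subr_ge0 clamp_homo.
Qed.

End UniformLaw.

Section CrossingLaw.
Context {d : measure_display} {T : measurableType d} {R : realType}.
Context (P : probability T R) {n : nat} (D L p : nat) (eps : R) (c : filler R n).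
Hypothesis D_gt0 : (0 < D)%N.
Hypothesis c_ok : filler_ok p eps c.
Variable s : 'I_n -> nat -> {RV P >-> R}.
Hypothesis s_unif : forall j m, uniform_on_unit (s j m).
Hypothesis s_indep : mutually_independent (fun jm : 'I_n * nat => s jm.1 jm.2).

Let K := ('I_n * 'I_L.+1)%type.
Let Om := {set 'I_L.+1}.

Definition hits_of (w : T) (k : K) : Om := hits D L c k.1 k.2 (s k.1 k.2 w).

Let hitset j m v : set R := [set x | v \in hits D L c j m x].

Let hit_itv j m v t : [set x | hit D c j m v t x] =
  [set` `]poured c v.-1 j - (m * D.+1 + t.+2)%:R, poured c v j - (m * D.+1 + t.+2)%:R]].
Proof.
apply/seteqP; split => x; rewrite /= in_itv /= /hit /threshold;
  by rewrite ltrBlDl lerBrDl.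
Qed.

Let hitsetE j m v : hitset j m v = \big[setU/set0]_(t < D) [set x | hit D c j m v t x].
Proof.
rewrite -bigcup_seq; apply/seteqP; split=> x; rewrite /hitset /= inE.
  by move=> /existsP[t h]; exists t => //=; rewrite mem_index_enum.
by move=> [t _ h]; apply/existsP; exists t.
Qed.

Let mhitset j m v : measurable (hitset j m v).
Proof.
by rewrite hitsetE; apply: bigsetU_measurable => t _; rewrite hit_itv; exact: measurable_itv.
Qed.

Lemma measurable_hits j m (a : Om) : measurable [set x : R | hits D L c j m x = a].
Proof.
have -> : [set x : R | hits D L c j m x = a] =
   \big[setI/setT]_(v : 'I_L.+1) (if v \in a then hitset j m v else ~` hitset j m v).
  rewrite -bigcap_seq; apply/seteqP; split=> x /=.
    by move=> <- v _; rewrite /hitset; case: ifP => // /negP.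
  move=> h; apply/setP => v; have := h v; rewrite /= mem_index_enum => /(_ isT).
  by case: ifP => // _ /negP/negbTE.
apply: bigsetI_measurable => v _; case: ifP => _; first exact: mhitset.
by apply: measurableC; exact: mhitset.
Qed.

Lemma measurable_hits_of k a : measurable [set w | hits_of w k = a].
Proof.
exact: (measurable_funPTI (s k.1 k.2) (measurable_hits k.1 k.2 a)).
Qed.

Lemma indep_hits_of (r : seq K) (om : K -> Om) : uniq r ->
  P (\big[setI/setT]_(k <- r) [set w | hits_of w k = om k]) =
  (\prod_(k <- r) P [set w | hits_of w k = om k])%E.
Proof.
move=> ur; pose g (k : K) : 'I_n * nat := (k.1, k.2 : nat).
pose B (i : 'I_n * nat) : set R :=
  [set x | hits D L c i.1 i.2 x = om (i.1, inord i.2)].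
have gi : injective g by move=> [a b] [a' b'] [-> /val_inj ->].
have gE k : (g k).1 = k.1 /\ (inord (g k).2 : 'I_L.+1) = k.2.
  by split=> //; apply: val_inj; rewrite /= inordK.
have := @s_indep (map g r) B; rewrite map_inj_uniq // => /(_ ur).
rewrite !big_map.
have E k : s (g k).1 (g k).2 @^-1` B (g k) = [set w | hits_of w k = om k].
  by apply/seteqP; split => w; rewrite /B /hits_of /= inord_val -surjective_pairing.
under eq_bigr do rewrite E.
under [in RHS]eq_bigr do rewrite E.
by apply=> i _; exact: measurable_hits.
Qed.

Let q := law P hits_of.

Lemma law_hits_mem j (m : 'I_L.+1) (v : 'I_L.+1) :
  \sum_a q (j, m) a * (v \in a)%:R <=
    clamp D%:R (poured c v j - 2 - m%:R * D.+1%:R) -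
    clamp D%:R (poured c v.-1 j - 2 - m%:R * D.+1%:R).
Proof.
have [_ E] := prob_Ex measurable_hits_of indep_hits_of (r := [:: (j, m)])
  (fun=> finset.set0) (S := fun om => v \in om (j, m)) isT
  (fun o1 o2 h => congr1 (fun A : Om => v \in A) (h (j, m) (mem_head _ _))).
rewrite /= -/q in E.
under eq_bigr => a _ do
  [rewrite (_ : (v \in a)%:R = (v \in upd (fun=> finset.set0) (j, m) a (j, m))%:R); last by rewrite /upd eqxx].
rewrite -lee_fin -E.
have -> : [set w | v \in hits_of w (j, m)] = \big[setU/set0]_(t < D)
   (s j m @^-1` [set x | hit D c j m v t x]).
  rewrite -bigcup_seq; apply/seteqP; split => w; rewrite /= inE.
    by move=> /existsP[t h]; exists t => //=; rewrite mem_index_enum.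
  by move=> [t _ h]; apply/existsP; exists t.
have mt t : measurable (s j m @^-1` [set x | hit D c j m v t x]).
  by apply: measurable_funPTI; rewrite hit_itv; exact: measurable_itv.
apply: (@le_trans _ _ (\sum_(t < D) P (s j m @^-1` [set x | hit D c j m v t x]))%E).
  elim: (index_enum _) => [|t r IH]; first by rewrite !big_nil measure0.
  rewrite !big_cons; apply: le_trans (measureU2 _ _ _) _ => //.
    exact: bigsetU_measurable.
  by rewrite leeD2l.
have clampE (z : R) : clamp D%:R z = \sum_(t < D) clamp 1 (z - t%:R).
  rewrite -[D%:R]mulr1 -sum_clamp // big_mkord.
  by apply: eq_bigr => t _; rewrite mulr1.
rewrite !clampE -sumrB -sumEFin; apply: lee_sum => t _; rewrite hit_itv.
apply: le_trans (uniform_itv_le (s_unif j m) _) _.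
  by rewrite lerB //; have /andP[] := poured_step c_ok v j.
have E' (z : R) : z - (m * D.+1 + t.+2)%:R = z - 2 - m%:R * D.+1%:R - t%:R.
  by rewrite -addn2 !natrD natrM; ring.
by rewrite !E'.
Qed.

Lemma mean_crossings (v : 'I_L.+1) : (0 < v)%N ->
  \sum_k \sum_a q k a * (v \in a)%:R <= (1 - eps) * p%:R.
Proof.
move=> v0; have [_ sum_c] := c_ok v0; apply: le_trans sum_c.
rewrite -(pair_bigA _ (fun j m => \sum_a q (j, m) a * (v \in a)%:R)) /=.
apply: ler_sum => j _.
set a' := poured c v j; set a := poured c v.-1 j.
have aa : a <= a' by have /andP[] := poured_step c_ok v j.
have -> : c v j = (a' - 2) - (a - 2).
  by rewrite /a' -(prednK v0) pouredS prednK // /a; ring.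
apply: le_trans (clamp_lipschitz (L.+1%:R * D.+1%:R) (lerB aa (lexx 2))).
rewrite -!sum_clamp // -sumrB big_mkord; apply: ler_sum => m _.
apply: le_trans (law_hits_mem j m v) _.
have clampS z : clamp D.+1%:R z = clamp D%:R z + clamp 1 (z - D%:R) :> R.
  by rewrite clampD // natr1.
rewrite -/a' -/a; set z' := a' - 2 - _; set z := a - 2 - _.
have zz : z - D%:R <= z' - D%:R by rewrite !lerD2r.
by have := clamp_homo 1 zz; rewrite !clampS; lra.
Qed.

Lemma law_supp k a : q k a != 0 -> (#|a| <= D)%N.
Proof.
move=> qa; have [w <-] : exists w, hits_of w k = a.
  apply: contrapT => nw; move/eqP: qa; apply; rewrite /q /law.
  rewrite (_ : [set w | _] = set0) ?measure0 //.
  by apply/seteqP; split=> // w hw; apply: nw; exists w.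
by apply: (hits_card L D_gt0 c_ok); have [h _] := s_unif k.1 k.2; exact: h.
Qed.

Lemma s01 w j m : 0 < s j m w <= 1.
Proof. by have [] := s_unif j m. Qed.

Lemma excess_hits w v : (v <= L)%N ->
  excess p D L c (fun j m => s j m w) v = excess_of p v (hits_of w).
Proof.
move=> vL; rewrite /excess /excess_of /total_crossings; congr (Num.max 0 (_ - _)).
rewrite -(pair_bigA _ (fun j m => ((inord v : 'I_L.+1) \in hits_of w (j, m))%:R)) /=.
apply: eq_bigr => j _; have := sum_hits_crosses D_gt0 c_ok (s01 w) j (inord v : 'I_L.+1).
by rewrite inordK // => <-; rewrite natr_sum.
Qed.

Lemma run_hits (delta : R) (rule : selection_rule R n) w w' v : (v <= L)%N ->
  (forall k, hits_of w k = hits_of w' k) ->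
  run D delta rule (fun j m => s j m w) c v = run D delta rule (fun j m => s j m w') c v.
Proof.
move=> + H; elim: v => [//|v IH] vL /=; rewrite IH ?(ltnW vL) //.
suff -> : pour D delta (fun j m => s j m w) c v.+1 =
   pour D delta (fun j m => s j m w') c v.+1 by [].
apply/funext => st; rewrite /pour; congr State; apply/funext => j.
rewrite !(counter_increment (L := L) D_gt0 c_ok (s01 _)) //.
have E w1 : crosses D L c (fun j m => s j m w1) j v.+1 =
   (\sum_(m < L.+1) ((inord v.+1 : 'I_L.+1) \in hits_of w1 (j, m)))%N :> nat.
  by rewrite (sum_hits_crosses D_gt0 c_ok (s01 w1)) inordK.
by rewrite !E; under eq_bigr do rewrite H.
Qed.

Section Union.
Variables (delta x : R).
Hypotheses (eps_gt0 : 0 < eps) (eps_le : eps <= 2^-1) (p_gt0 : (0 < p)%N).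
Hypothesis deltaV : delta^-1 = D%:R.
Hypothesis small_mean : 2 / eps * expR (- (eps ^+ 2 * p%:R / 4)) <= delta / 12.
Hypothesis x_ge1 : 1 <= x.
Let eta := delta ^+ 2 / (12 * p%:R).

Let level (u len : nat) : R := (Num.sqrt (x ^+ 2 + (L - u)%:R) + delta * len%:R) / 3.

Definition few_excess_event (om : K -> Om) : bool :=
  [forall u : 'I_L.+1, forall len : 'I_L.+1, (len <= u)%N ==>
     (\sum_(u - len <= v < u) excess_of p v.+1 om <= level u len)].

Lemma few_excess_prob : (1 - ((768 * 81 * 8 * 36) / (eta ^+ 6 * delta ^+ 2) *
    expR (- (eta * x / 6)))%:E <= P [set w | few_excess_event (hits_of w)])%E.
Proof.
have D0 : 0 < D%:R :> R by rewrite ltr0n.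
have P0 : 0 < p%:R :> R by rewrite ltr0n.
have p1 : 1 <= p%:R :> R by rewrite ler1n.
have deltaE : delta = D%:R^-1 by rewrite -deltaV invrK.
have d0 : 0 < delta by rewrite deltaE invr_gt0.
have d1 : delta <= 1 by rewrite deltaE invf_le1 // ler1n.
have eta0 : 0 < eta by rewrite divr_gt0 ?exprn_gt0 ?mulr_gt0.
have eta1 : eta <= 1.
  rewrite /eta ler_pdivrMr ?mulr_gt0 // mul1r.
  by apply: (@le_trans _ _ 1); [rewrite expr_le1 // ltW|lra].
have um := index_enum_uniq K.
have q0 := law_ge0 P hits_of; have q1 := law_sum1 P measurable_hits_of.
pose E F := Ex q (index_enum K) F (fun=> finset.set0).
have [mS PS] := prob_Ex measurable_hits_of indep_hits_of (fun=> finset.set0)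
  (S := fun om => ~~ few_excess_event om) um
  (fun o1 o2 h => congr1 (fun f => ~~ few_excess_event f)
     (funext (fun k => h k (mem_index_enum k)))).
have -> : [set w | few_excess_event (hits_of w)] =
   ~` [set w | ~~ few_excess_event (hits_of w)].
  by apply/seteqP; split => w /=; [move=> -> //|move/negP; rewrite negbK].
rewrite probability_setC // leeB // PS lee_fin -/(E _).
apply: (@le_trans _ _ (E (fun om => \sum_(u < L.+1) \sum_(len < L.+1)
    ((len <= u)%N && (level u len < \sum_(u - len <= v < u) excess_of p v.+1 om))%:R))).
  apply: Ex_le => // om; case: (boolP (few_excess_event om)) => /= [_|].
    by apply: sumr_ge0 => u _; apply: sumr_ge0.
  rewrite negb_forall => /existsP[u]; rewrite negb_forall => /existsP[len].
  rewrite negb_imply -ltNge => h.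
  rewrite (bigD1 u) //= (bigD1 len) //= h -addrA lerDl.
  by rewrite addr_ge0 // sumr_ge0 // => i _; apply: sumr_ge0.
rewrite /E Ex_sum //.
apply: (@le_trans _ _ (\sum_(u < L.+1) \sum_(len < L.+1)
   expR (- (eta / 3 * Num.sqrt (x ^+ 2 + (L - u)%:R))) *
     expR (- (eta * delta / 6 * len%:R)))).
  apply: ler_sum => u _; rewrite Ex_sum //; apply: ler_sum => len _.
  case: (leqP len u) => Tu /=; last by rewrite Ex_cst // mulr_ge0 ?expR_ge0.
  have := @excess_tail _ _ D L p eps delta q q0 q1 mean_crossings law_supp
    eps_gt0 eps_le p_gt0 D_gt0 deltaV len u (Num.sqrt (x ^+ 2 + (L - u)%:R)) Tu (ltn_ord u).
  rewrite -/eta => /(_ _)/le_trans; apply.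
    move=> v vL; apply: le_trans small_mean.
    exact: (mean_excess q0 q1 mean_crossings eps_gt0 eps_le).
  by rewrite (mulrAC eta).
under eq_bigr do rewrite -mulr_sumr.
rewrite -mulr_suml.
have H1 : \sum_(u < L.+1) expR (- (eta / 3 * Num.sqrt (x ^+ 2 + (L - u)%:R))) <=
    768 / (eta / 3) ^+ 4 * expR (- (eta / 3 * x / 2)).
  apply: le_trans (sum_expR_sqrt L.+1 _ x_ge1); last by lra.
  rewrite big_mkord (reindex_inj rev_ord_inj) /=.
  apply: ler_sum => u _; rewrite ler_expR lerN2 ler_wpM2l //; first by lra.
  by rewrite subSS subKn // -ltnS.
have H2 : \sum_(len < L.+1) expR (- (eta * delta / 6 * len%:R)) <=
    8 / (eta * delta / 6) ^+ 2.
  rewrite -(big_mkord xpredT (fun len : nat => expR (- (eta * delta / 6 * len%:R)))).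
  apply: sum_expR_linear; have : 0 < eta * delta by rewrite mulr_gt0.
  by have : eta * delta <= 1; [rewrite mulr_ile1 // ltW|lra].
apply: (le_trans (ler_pM _ _ H1 H2)).
- by apply: sumr_ge0 => u _; exact: expR_ge0.
- by apply: sumr_ge0 => u _; exact: expR_ge0.
rewrite (_ : eta / 3 * x / 2 = eta * x / 6); last by field.
rewrite le_eqVlt; apply/orP; left; apply/eqP; field.
by rewrite !gt_eqF.
Qed.

End Union.

End CrossingLaw.

(** * Choice of the constants *)

Section Numerics.
Context {R : realType} (m p D : nat) (eps delta gamma k : R).
Hypotheses (p_gt0 : (1 <= p)%N) (gamma_le : gamma <= m%:R).
Hypotheses (eps_ge : p%:R `^ (- 3^-1) <= eps) (eps_le : eps <= 2^-1).
Hypotheses (delta_ge : p%:R `^ (- gamma) <= delta) (deltaV : delta^-1 = D%:R).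

Let p1 : 1 <= p%:R :> R. Proof. by rewrite ler1n. Qed.
Let p0 : 0 < p%:R :> R. Proof. exact: lt_le_trans p1. Qed.

Lemma eps_positive : 0 < eps.
Proof. by apply: lt_le_trans eps_ge; apply: powR_gt0. Qed.

Lemma delta_positive : 0 < delta.
Proof. by apply: lt_le_trans delta_ge; apply: powR_gt0. Qed.

Let e0 := eps_positive.
Let d0 := delta_positive.

Lemma eps_cube : 1 <= eps ^+ 3 * p%:R.
Proof.
rewrite -ler_pdivrMr // mul1r -powR_inv1 ?(ltW p0) //.
apply: (@le_trans _ _ ((p%:R `^ (- 3^-1)) ^+ 3)); last first.
  by rewrite lerXn2r ?nnegrE ?powR_ge0 // ltW.
rewrite -powR_mulrn ?powR_ge0 // -powRrM.
by rewrite mulNr mulVf.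
Qed.

Lemma inv_eps_le : eps^-1 <= eps ^+ 2 * p%:R.
Proof.
rewrite -[eps^-1]mul1r ler_pdivrMr //.
by have := eps_cube; rewrite exprS; lra.
Qed.

Lemma epsp_ge1 : 1 <= eps * p%:R.
Proof.
apply: (le_trans eps_cube); rewrite ler_wpM2r ?(ltW p0) // exprS.
rewrite -[leRHS]mulr1 ler_wpM2l ?(ltW e0) //.
by rewrite expr_le1 ?(ltW e0) //; have := eps_le; lra.
Qed.

Lemma p_ge8 : 8 <= p%:R :> R.
Proof.
have h : eps ^+ 3 <= 2^-1 ^+ 3 by rewrite lerXn2r ?nnegrE ?(ltW e0) // invr_ge0.
have : eps ^+ 3 * p%:R <= 2^-1 ^+ 3 * p%:R by rewrite ler_wpM2r // ltW.
have := eps_cube; rewrite [2^-1 ^+ 3](_ : _ = 8^-1); last by field.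
lra.
Qed.

Lemma D_le : D%:R <= p%:R ^+ m :> R.
Proof.
rewrite -deltaV -powR_mulrn ?(ltW p0) //.
apply: (@le_trans _ _ (p%:R `^ gamma)); last exact: ler_powR.
rewrite -[leRHS]invrK lef_pV2 ?posrE ?invr_gt0 ?powR_gt0 //.
by rewrite -powRN.
Qed.

Lemma mean_excess_bound_le : 192 * expR (- (8^-1 * eps ^+ 2 * p%:R)) <= delta ->
  2 / eps * expR (- (eps ^+ 2 * p%:R / 4)) <= delta / 12.
Proof.
set z := 8^-1 * eps ^+ 2 * p%:R => Hz.
have -> : expR (- (eps ^+ 2 * p%:R / 4)) = expR (- z) * expR (- z).
  by rewrite -expRD; congr expR; rewrite /z; field.
have h : 2 / eps * expR (- z) <= 16.
  rewrite expRN ler_pdivrMr ?expR_gt0 //.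
  have := inv_eps_le; have := expR_ge1Dx z.
  have -> : eps ^+ 2 * p%:R = 8 * z by rewrite /z; field.
  lra.
have := ler_wpM2r (expR_ge0 (- z)) h.
lra.
Qed.

Let K := expR k.
Hypothesis k_ge : ln p%:R <= k.

Lemma p_le_expR : p%:R <= K.
Proof. by rewrite -[leLHS]lnK ?posrE // ler_expR. Qed.

Let pK := p_le_expR.
Let K8 : 8 <= K. Proof. exact: le_trans p_ge8 pK. Qed.
Let K0 : 0 < K. Proof. exact: expR_gt0. Qed.
Let K1 : 1 <= K. Proof. by have := K8; lra. Qed.
Let D0 : 0 < D%:R :> R. Proof. by rewrite -deltaV invr_gt0. Qed.
Let DK : D%:R <= K ^+ m.
Proof. by apply: (le_trans D_le); rewrite lerXn2r ?nnegrE ?(ltW K0) ?(ltW p0). Qed.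

Lemma k_ge1 : 1 <= k.
Proof.
rewrite -ler_expR -/K; apply: le_trans K8.
have h : expR 4^-1 <= 3 / 2 :> R.
  by apply: (le_trans (expR_quadratic (lexx _))); lra.
have -> : expR 1 = expR 4^-1 ^+ 4 :> R.
  by rewrite -expRM_natl; congr expR; field.
have : expR 4^-1 ^+ 4 <= (3 / 2) ^+ 4 :> R.
  by rewrite lerXn2r ?nnegrE ?expR_ge0 //; lra.
have -> : (3 / 2) ^+ 4 = 81 / 16 :> R by field.
lra.
Qed.

Let eta := delta ^+ 2 / (12 * p%:R).
(* This is [12 * K / eta], which makes the tail exponent [eta * base_level / 6]
   equal to [2 * K]. *)
Definition base_level := 144 * K * p%:R * D%:R ^+ 2.

Let deltaE : delta = D%:R^-1. Proof. by rewrite -deltaV invrK. Qed.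

Lemma base_level_ge1 : 1 <= base_level.
Proof.
have D1 : 1 <= D%:R :> R by move: D0; rewrite ltr0n ler1n.
have D2 : 1 <= D%:R ^+ 2 :> R by rewrite expr_ge1.
have h : 1 <= 144 * K by have := K1; lra.
by apply: mulr_ege1 => //; apply: mulr_ege1.
Qed.

Lemma kap_base_level : 2 <= eps * delta / 32 * base_level.
Proof.
have D1 : 1 <= D%:R :> R by move: D0; rewrite ltr0n ler1n.
have -> : eps * delta / 32 * base_level = 144 / 32 * K * (eps * p%:R) * D%:R.
  by rewrite /base_level deltaE; field; rewrite gt_eqF.
have h : 2 <= 144 / 32 * K by have := K1; lra.
apply: (le_trans h); rewrite -[leRHS]mulrA ler_peMr ?(le_trans _ h) //.
by apply: mulr_ege1 => //; exact: epsp_ge1.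
Qed.

Lemma tail_le (c : R) : 0 <= c ->
  c / (eta ^+ 6 * delta ^+ 2) * expR (- (eta * base_level / 6)) <=
  c * 12 ^+ 6 * (14 * m + 7)`!%:R * expR (- K).
Proof.
move=> c_ge0.
have Dn : D%:R != 0 :> R by rewrite gt_eqF.
have pn : p%:R != 0 :> R by rewrite gt_eqF.
have -> : eta * base_level / 6 = K + K.
  by rewrite /eta /base_level deltaE; field; rewrite ?Dn ?pn.
have -> : c / (eta ^+ 6 * delta ^+ 2) = c * 12 ^+ 6 * (p%:R ^+ 6 * D%:R ^+ 14).
  by rewrite /eta deltaE; field; rewrite ?Dn ?pn.
have : 0 <= c * 12 ^+ 6 := mulr_ge0 c_ge0 (exprn_ge0 6 (ler0n R 12)).
move: (c * 12 ^+ 6) => c' c'_ge0.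
rewrite -!(mulrA c') ler_wpM2l //.
rewrite opprD expRD mulrA ler_wpM2r ?expR_ge0 //.
have h : p%:R ^+ 6 * D%:R ^+ 14 <= K ^+ (14 * m + 6).
  have -> : K ^+ (14 * m + 6) = K ^+ 6 * (K ^+ m) ^+ 14.
    by rewrite -exprM (mulnC m) -exprD addnC.
  by apply: ler_pM; rewrite ?exprn_ge0 ?(ltW p0) ?(ltW D0) // lerXn2r ?nnegrE
    ?exprn_ge0 ?(ltW p0) ?(ltW D0) ?(ltW K0).
apply: (le_trans (ler_pM _ (expR_ge0 _) h (expRN_le (14 * m + 6) K0))).
  by rewrite mulr_ge0 // exprn_ge0 ?(ltW p0) ?(ltW D0).
rewrite (addnS _ 6); set N := (14 * m + 6)%N.
have -> : K ^+ N * (N.+1`!%:R / K ^+ N.+1) = N.+1`!%:R / K.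
  by rewrite exprS; field; rewrite expf_neq0 !gt_eqF.
by rewrite ler_pdivrMr // ler_peMr ?ler0n.
Qed.

Lemma potential_le : 1 + 8 / (eps * delta / 32) * base_level ^+ 2 <=
  expR (k * (5 * m + 15)%:R).
Proof.
rewrite expRM_natr -/K.
have Dn : D%:R != 0 :> R by rewrite gt_eqF.
have en : eps != 0 by rewrite gt_eqF.
have -> : 8 / (eps * delta / 32) * base_level ^+ 2 =
   256 * 144 ^+ 2 * (eps^-1 * (D%:R ^+ 5 * (K * p%:R) ^+ 2)).
  by rewrite /base_level deltaE; field; rewrite ?Dn ?en.
have eK : eps^-1 <= K.
  apply: (le_trans _ pK); rewrite -[eps^-1]mul1r ler_pdivrMr // mulrC.
  exact: epsp_ge1.
have h : eps^-1 * (D%:R ^+ 5 * (K * p%:R) ^+ 2) <= K ^+ (5 * m + 5).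
  have -> : K ^+ (5 * m + 5) = K * ((K ^+ m) ^+ 5 * (K * K) ^+ 2).
    by rewrite -exprM mulnC exprD; ring.
  apply: ler_pM; rewrite ?invr_ge0 ?(ltW e0) //.
    by rewrite mulr_ge0 ?exprn_ge0 ?mulr_ge0 ?(ltW p0) ?(ltW D0) ?(ltW K0).
  apply: ler_pM; rewrite ?exprn_ge0 ?mulr_ge0 ?(ltW p0) ?(ltW D0) ?(ltW K0) //.
    by rewrite lerXn2r ?nnegrE ?exprn_ge0 ?(ltW D0) ?(ltW K0).
  rewrite lerXn2r ?nnegrE ?mulr_ge0 ?(ltW p0) ?(ltW K0) //.
  by rewrite ler_wpM2l // ltW.
have K3 : 512 <= K ^+ 3.
  have -> : 512 = 8 ^+ 3 :> R by ring.
  by rewrite lerXn2r ?nnegrE ?(ltW K0).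
have q1 : 1 <= K ^+ (5 * m + 5) by rewrite exprn_ege1.
have -> : K ^+ (5 * m + 15) = K * (K ^+ 3 * (K ^+ 3) ^+ 2) * K ^+ (5 * m + 5).
  rewrite (_ : 5 * m + 15 = 10 + (5 * m + 5))%N; last by rewrite addnCA.
  by rewrite exprD; congr (_ * _); ring.
have c9 : 256 * 144 ^+ 2 <= K ^+ 3 * (K ^+ 3) ^+ 2.
  have h256 : 256 <= K ^+ 3 by lra.
  have h144 : 144 <= K ^+ 3 by lra.
  have h144' : 144 ^+ 2 <= (K ^+ 3) ^+ 2.
    by rewrite ler_sqr // nnegrE; lra.
  by apply: ler_pM (ler0n _ _) (exprn_ge0 2 (ler0n _ 144)) h256 h144'.
set c := 256 * 144 ^+ 2 in c9 *; set c' := K ^+ 3 * _ in c9 *.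
set Z := eps^-1 * _ in h *; set Q := K ^+ (5 * m + 5) in h q1 *.
have c0 : 0 <= c := mulr_ge0 (ler0n R 256) (exprn_ge0 2 (ler0n R 144)).
have c1 : 1 <= c' by rewrite mulr_ege1 ?exprn_ege1 //; lra.
have h1 : c * Z <= c' * Q.
  by apply: (le_trans (ler_wpM2l c0 h)); rewrite ler_wpM2r //; lra.
have h2 : 1 <= c' * Q by rewrite mulr_ege1.
have h3 : 8 * (c' * Q) <= K * (c' * Q) by rewrite ler_wpM2r //; lra.
rewrite -mulrA; lra.
Qed.

Lemma fill_le_of_expR (f : R) :
  expR (eps / 16 * (f - 8)) <= 1 + 8 / (eps * delta / 32) * base_level ^+ 2 ->
  f <= (8 + 16 * (5 * m + 15)%:R) * k / eps.
Proof.
move=> /le_trans/(_ potential_le); rewrite ler_expR => h.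
have k1 := k_ge1; have e2 := eps_le.
rewrite ler_pdivlMr //; set N := (5 * m + 15)%:R in h *.
have : 8 * eps <= 8 * k by lra.
lra.
Qed.

End Numerics.

Theorem theorem7p1 (R : realType) :
  exists alpha beta : R, [/\ 0 < alpha, 0 < beta &
  forall gamma : R, 0 < gamma ->
  exists C1 C2 : R, [/\ 0 < C1, 0 < C2 &
  forall (n p D : nat) (eps delta : R),
    (1 <= n)%N -> (1 <= p)%N ->
    p%:R `^ (- 3^-1) <= eps -> eps <= 2^-1 ->
    p%:R `^ (- gamma) <= delta ->
    alpha * expR (- (beta * eps ^+ 2 * p%:R)) <= delta ->
    delta < 1 ->
    delta^-1 = D%:R ->
  forall (d : measure_display) (T : measurableType d) (P : probability T R)
    (s : 'I_n -> nat -> {RV P >-> R}),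
    (forall j m, uniform_on_unit (s j m)) ->
    mutually_independent (fun jm : 'I_n * nat => s jm.1 jm.2) ->
  forall rule : selection_rule R n, smoothed_greedy_rule p delta rule ->
  forall c : filler R n, filler_ok p eps c ->
  forall (i : nat) (k : R), ln p%:R <= k ->
    ((1 - C2 * expR (- expR k))%:E <=
      P [set w | (backlog (run D delta rule (fun j m => s j m w) c i)
                    <= C1 * k / eps)%R])%E]].
Proof.
have c_gt0 : 0 < 768 * 81 * 8 * 36 :> R by lra.
have c12 : 0 < 12 ^+ 6 :> R by rewrite exprn_gt0.
exists 192, 8^-1; split=> // gamma gamma_gt0.
set m := (Num.truncn gamma).+1.
have gamma_le : gamma <= m%:R by apply: ltW; exact: truncnS_gt.
exists (8 + 16 * (5 * m + 15)%:R).
exists (768 * 81 * 8 * 36 * 12 ^+ 6 * (14 * m + 7)`!%:R); split.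
- by rewrite ltr_wpDr ?mulr_ge0.
- by apply: mulr_gt0 (mulr_gt0 c_gt0 c12) _; rewrite ltr0n fact_gt0.
move=> n p D eps delta _ p_gt0 eps_ge eps_le delta_ge delta_exp delta_lt1 deltaV.
move=> d T P s s_unif s_indep rule rule_ok c c_ok i k k_ge.
have eps0 := eps_positive p_gt0 eps_ge.
have delta0 := delta_positive p_gt0 delta_ge.
have D_gt0 : (0 < D)%N by rewrite -(ltr_nat R) -deltaV invr_gt0.
have small_mean := mean_excess_bound_le p_gt0 eps_ge delta_exp.
have epsp := epsp_ge1 p_gt0 eps_ge eps_le.
have x1 := base_level_ge1 p_gt0 eps_ge eps_le delta_ge deltaV k_ge.
have kx := kap_base_level p_gt0 eps_ge eps_le delta_ge deltaV k_ge.
set x := base_level p D k in x1 kx.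
set B := [set w | _].
have hitsP := measurable_hits_of (L := i) D c s.
have indepP := indep_hits_of (L := i) D c s_indep.
pose S (om : 'I_n * 'I_i.+1 -> {set 'I_i.+1}) : bool :=
  `[< exists w, hits_of D c s w = om /\ B w >].
have BE : B = [set w | S (hits_of D c s w)].
  apply/seteqP; split => w /=; first by move=> Bw; apply/asboolP; exists w.
  move=> /asboolP[w' [E Bw']]; move: Bw'; rewrite /B /=.
  rewrite (run_hits D_gt0 c_ok s_unif delta rule (leqnn i) (w' := w)) //.
  by move=> k'; rewrite E.
have mB : measurable B.
  rewrite BE; have [] := prob_Ex hitsP indepP (fun=> finset.set0) (S := S)
    (index_enum_uniq _) (fun o1 o2 h => congr1 S (funext (fun k => h k (mem_index_enum k)))).
  by [].
have mG : measurable [set w | few_excess_event p delta x (hits_of (L := i) D c s w)].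
  have [] := prob_Ex hitsP indepP (fun=> finset.set0)
    (S := fun om => few_excess_event p delta x om)
    (index_enum_uniq _) (fun o1 o2 h => congr1 (fun f => few_excess_event p delta x f)
       (funext (fun k => h k (mem_index_enum k)))).
  by [].
apply: (@le_trans _ _ (P [set w | few_excess_event p delta x (hits_of (L := i) D c s w)])).
  apply: le_trans (few_excess_prob i D_gt0 c_ok s_unif s_indep eps0 eps_le p_gt0
    deltaV small_mean x1).
  rewrite lee_fin lerB //.
  exact: (tail_le p_gt0 gamma_le eps_ge eps_le delta_ge deltaV k_ge (ltW c_gt0)).
apply: le_measure; rewrite ?inE // => w /= good; rewrite /B /=.
have bound j : fill (run D delta rule (fun j m => s j m w) c i) j <=
    (8 + 16 * (5 * m + 15)%:R) * k / eps.
  apply: (fill_le_of_expR p_gt0 gamma_le eps_ge eps_le delta_ge deltaV k_ge).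
  apply: (expR_fill_le (L := i) eps0 eps_le epsp delta0 delta_lt1 deltaV c_ok
    (s01 s_unif w) rule_ok x1 kx).
  move=> u len lu ui.
  have := good => /forallP/(_ (inord u))/forallP/(_ (inord len)).
  rewrite !inordK ?ltnS ?(leq_trans lu ui) // lu /=; apply: le_trans.
  rewrite big_nat [leRHS]big_nat; apply: ler_sum => v /andP[_ vu].
  by rewrite (excess_hits D_gt0 c_ok s_unif) ?(leq_trans vu ui).
apply: bigmax_le => // .
have k1 := k_ge1 p_gt0 eps_ge eps_le k_ge.
by rewrite divr_ge0 ?mulr_ge0 ?addr_ge0 ?mulr_ge0 ?(ltW eps0) //; lra.
Qed.
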